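(* Let $\mathbb{F}$ be a field with $|\mathbb{F}|\ge 4$ and let $A$ be a unital associative algebraic $\mathbb{F}$-algebra. Then the group of units $A^\times$ is solvable if and only if all of the following conditions hold: (i) $A$ is Lie solvable; (ii) $A/\mathcal{J}(A)$ is commutative; (iii) there exists a chain $0=J_0\subseteq J_1\subseteq\cdots\subseteq J_m=\mathcal{J}(A)$ of ideals of $\mathcal{J}(A)$ such that, for every $i=1,\dots,m$, the factor $J_i/J_{i-1}$ is the sum of commutative ideals of $J_m/J_{i-1}$.
   Context: $A^\times$ is the group of multiplicative units of $A$, and $\mathcal{J}(A)$ is the Jacobson radical of $A$. An algebra is algebraic if each of its elements is algebraic over $\mathbb{F}$. An associative algebra is regarded as a Lie algebra via $[a,b]=ab-ba$; $A$ is called Lie solvable if it is solvable as a Lie algebra. In (iii), ''ideals of $\mathcal{J}(A)$'' means two-sided ideals of $\mathcal{J}(A)$ regarded as a (not necessarily unital) associative algebra; a commutative ideal is an ideal whose elements commute with one another. *)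

(* Defs.v *)
From HB Require Import structures.
From mathcomp Require Import all_boot all_algebra.
From mathcomp Require Import boolp classical_sets functions cardinality.

Set Implicit Arguments.
Unset Strict Implicit.
Unset Printing Implicit Defensive.

Import GRing.Theory.
Local Open Scope classical_set_scope.
Local Open Scope ring_scope.

(* A unit is stored together with its (unique) two-sided inverse, so that the
   units of an arbitrary, possibly infinite, ring form a groupType without
   assuming that invertibility is decidable. *)
Record ring_units (A : nzRingType) := RingUnit {
  unit_pair : A * A;
  _ : (unit_pair.1 * unit_pair.2 == 1) && (unit_pair.2 * unit_pair.1 == 1)
}.

Section RingUnits.
Variable A : nzRingType.
Local Notation U := (ring_units A).

HB.instance Definition _ := [isSub for @unit_pair A].
HB.instance Definition _ := [Choice of U by <:].

Implicit Types u v w : U.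

Fact unit_one_subproof : ((1 : A) * 1 == 1) && ((1 : A) * 1 == 1).
Proof. by rewrite mulr1 eqxx. Qed.
Definition unit_one : U := @RingUnit A (1, 1) unit_one_subproof.

Fact unit_inv_subproof u :
  ((unit_pair u).2 * (unit_pair u).1 == 1) &&
  ((unit_pair u).1 * (unit_pair u).2 == 1).
Proof. by rewrite andbC; case: u. Qed.
Definition unit_inv u : U :=
  @RingUnit A ((unit_pair u).2, (unit_pair u).1) (unit_inv_subproof u).

Fact unit_mul_subproof u v :
  ((unit_pair u).1 * (unit_pair v).1 *
     ((unit_pair v).2 * (unit_pair u).2) == 1) &&
  ((unit_pair v).2 * (unit_pair u).2 *
     ((unit_pair u).1 * (unit_pair v).1) == 1).
Proof.
case: u v => [[a a'] /= /andP[/eqP aa' /eqP a'a]].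
case=> [[b b'] /= /andP[/eqP bb' /eqP b'b]].
rewrite mulrA -(mulrA a) bb' mulr1 aa' eqxx /=.
by rewrite mulrA -(mulrA b') a'a mulr1 b'b.
Qed.
Definition unit_mul u v : U :=
  @RingUnit A ((unit_pair u).1 * (unit_pair v).1,
               (unit_pair v).2 * (unit_pair u).2) (unit_mul_subproof u v).

Fact unit_mulA : associative unit_mul.
Proof. by move=> u v w; apply: val_inj; rewrite /= !mulrA. Qed.

Fact unit_mul1l : left_id unit_one unit_mul.
Proof. by move=> u; apply: val_inj; case: u => -[a b] p; rewrite /= mul1r mulr1. Qed.

Fact unit_mul1r : right_id unit_one unit_mul.
Proof. by move=> u; apply: val_inj; case: u => -[a b] p; rewrite /= mul1r mulr1. Qed.

Fact unit_mulVl : left_inverse unit_one unit_inv unit_mul.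
Proof.
move=> u; apply: val_inj; case: u => -[a b] /= p.
by case/andP: (p) => _ /eqP ->.
Qed.

Fact unit_mulVr : right_inverse unit_one unit_inv unit_mul.
Proof.
move=> u; apply: val_inj; case: u => -[a b] /= p.
by case/andP: (p) => /eqP ->.
Qed.

HB.instance Definition _ :=
  isGroup.Build U unit_mulA unit_mul1l unit_mul1r unit_mulVl unit_mulVr.

End RingUnits.

Section Solvable.
Variable G : groupType.

Definition is_subgroup (H : set G) : Prop :=
  H 1%g /\ forall x y, H x -> H y -> H (x / y)%g.

Fixpoint derived_series (n : nat) : set G :=
  if n is k.+1 then
    smallest is_subgroup
      [set [~ x, y]%g | x in derived_series k & y in derived_series k]
  else setT.

Definition group_solvable : Prop := exists n, derived_series n = [set 1%g].

End Solvable.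

Section JacobsonRadical.
Variable A : nzRingType.

Definition is_left_ideal (L : set A) : Prop :=
  [/\ L 0, forall x y, L x -> L y -> L (x + y)
    & forall a x, L x -> L (a * x)].

Definition is_maximal_left_ideal (M : set A) : Prop :=
  [/\ is_left_ideal M, M <> setT
    & forall L, is_left_ideal L -> M `<=` L -> L = M \/ L = setT].

Definition jacobson_radical : set A :=
  \bigcap_(M in [set M | is_maximal_left_ideal M]) M.

End JacobsonRadical.

Section Algebras.
Variables (F : fieldType) (A : algType F).

Definition algebraic_algebra : Prop :=
  forall a : A, exists2 p : {poly F}, p != 0 & horner_alg a p = 0.

Definition is_subspace (V : set A) : Prop :=
  V 0 /\ forall (k : F) x y, V x -> V y -> V (k *: x + y).

Definition lie_bracket (a b : A) : A := a * b - b * a.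

Fixpoint lie_derived_series (n : nat) : set A :=
  if n is k.+1 then
    smallest is_subspace
      [set lie_bracket x y | x in lie_derived_series k
                           & y in lie_derived_series k]
  else setT.

Definition lie_solvable : Prop := exists n, lie_derived_series n = [set 0].

(* Two-sided ideals of a subalgebra B that need not contain 1. As B is not
   unital, closure under scalars is a separate requirement. *)
Definition is_ideal_of (B I : set A) : Prop :=
  [/\ I `<=` B, is_subspace I
    & forall b x, B b -> I x -> I (b * x) /\ I (x * b)].

(* If N is an ideal of a subalgebra B, the quotient algebra B / N is the set of
   cosets b + N with b in B. Its operations are computed on representatives:
   k (x + N) + (y + N) = (k x + y) + N and (x + N)(y + N) = x y + N. *)
Definition coset_of_set (N : set A) (x : A) : set A := [set x + n | n in N].

Definition quotient_set (B N : set A) : set (set A) := coset_of_set N @` B.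

Definition is_quotient_ideal (B N : set A) (K : set (set A)) : Prop :=
  [/\ K `<=` quotient_set B N,
      K (coset_of_set N 0),
      forall (k : F) x y, K (coset_of_set N x) -> K (coset_of_set N y) ->
        K (coset_of_set N (k *: x + y))
    & forall b x, B b -> K (coset_of_set N x) ->
        K (coset_of_set N (b * x)) /\ K (coset_of_set N (x * b))].

Definition quotient_commutative (N : set A) (K : set (set A)) : Prop :=
  forall x y, K (coset_of_set N x) -> K (coset_of_set N y) ->
    coset_of_set N (x * y) = coset_of_set N (y * x).

(* Sum of an arbitrary family of ideals of B / N: all finite sums of cosets
   lying in members of the family (the empty sum being the zero coset N). *)
Definition quotient_sum (N : set A) (KK : set (set (set A))) : set (set A) :=
  [set C | exists n (x : 'I_n -> A),
     (forall i, exists2 K, KK K & K (coset_of_set N (x i))) /\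
     C = coset_of_set N (\sum_(i < n) x i)].

Definition sum_of_commutative_ideals (B N : set A) (K : set (set A)) : Prop :=
  exists KK : set (set (set A)),
    (forall L, KK L -> is_quotient_ideal B N L /\ quotient_commutative N L) /\
    K = quotient_sum N KK.

End Algebras.

Arguments algebraic_algebra {F} A.
Arguments lie_solvable {F} A.

(* Main.v *)
Require Import Defs.
From HB Require Import structures.
From mathcomp Require Import all_boot all_algebra.
From mathcomp Require Import boolp classical_sets functions cardinality.
From mathcomp Require Import ring.

Set Implicit Arguments.
Unset Strict Implicit.
Unset Printing Implicit Defensive.

Import GRing.Theory.
Local Open Scope classical_set_scope.
Local Open Scope ring_scope.

(* Let J be the Jacobson radical and N = 1 + J.

   A non-nilpotent product y x with x^2 in J yields 2 x 2 matrix units in A/J,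
   hence a copy of SL_2(F), which is perfect when F has at least four elements;
   so A/J is reduced. In a reduced algebraic algebra a Hua-type argument,
   going up the derived series, shows that units with central commutators are
   central, so A/J is commutative.

   Inside J, call R(I) the sum of the ideals whose square lies in I. Let M be a
   normal subgroup of A^x contained in N. If [M, M] is central modulo I, then
   (z - 1)^3 lies in I for every commutator z = [a, m]. If M is commutative
   modulo I, it generates a commutative conjugation-invariant subspace E; for
   x in E and r in J, p = [r, x] (t + r)^-1 (s + r)^-1 lies in E and has square
   zero for distinct nonzero scalars t, s, and a square-zero x in E has xJx in
   R(I) because x s x and all conjugates of x lie in E. Iterating along the
   derived series gives [J, J] <= R^c(0), and R^i(0), followed by J, is the
   chain of (iii).

   Given a chain as in (iii), if x and y lie in commutative ideals modulo K
   then the group commutator of 1 + x and 1 + y is 1 + [x, y] modulo K, so that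
   derived length as a Lie algebra and as a group control each other on every
   factor. *)

(** * Quotient algebras *)

Section AlgebraQuotient.
Local Open Scope quotient_scope.
Variables (F : fieldType) (A : algType F).

Record proper_two_sided_ideal := ProperTwoSidedIdeal {
  ideal_set : set A;
  ideal_setP : is_ideal_of [set: A] ideal_set;
  ideal_set1 : ~ ideal_set 1
}.

Variable I : proper_two_sided_ideal.

Definition ideal_pred : pred A := fun x => `[< ideal_set I x >].

Lemma ideal_predP x : reflect (ideal_set I x) (x \in ideal_pred).
Proof. exact: asboolP. Qed.

Fact ideal_pred_zmod : zmod_closed ideal_pred.
Proof.
case: (ideal_setP I) => _ [I0 ID] _.
split=> [|x y /ideal_predP Ix /ideal_predP Iy]; apply/ideal_predP => //.
by rewrite addrC -scaleN1r; apply: ID.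
Qed.
HB.instance Definition _ := GRing.isZmodClosed.Build A ideal_pred ideal_pred_zmod.

Definition algebra_quot := @Quotient.quot A (GRing.ZmodClosed.clone A ideal_pred _).
HB.instance Definition _ := Choice.on algebra_quot.
HB.instance Definition _ := GRing.Zmodule.on algebra_quot.
HB.instance Definition _ := EqQuotient.on algebra_quot.

Let qpi (x : A) : algebra_quot := \pi_algebra_quot x.
Let qpi_eq x y : (qpi x = qpi y) <-> ideal_set I (x - y).
Proof.
split=> [/eqP|H]; first by rewrite -Quotient.idealrBE => /ideal_predP.
by apply/eqP; rewrite -Quotient.idealrBE; apply/ideal_predP.
Qed.
Let qpi_repr x : qpi (repr x) = x.
Proof. exact: reprK. Qed.
Let qpi_add x y : qpi (x + y) = qpi x + qpi y.
Proof. by rewrite /qpi !piE. Qed.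

Let one : algebra_quot := qpi 1.
Let mul (x y : algebra_quot) : algebra_quot := qpi (repr x * repr y).
Let scale (k : F) (x : algebra_quot) : algebra_quot := qpi (k *: repr x).

Let qpi_mul x y : mul (qpi x) (qpi y) = qpi (x * y).
Proof.
apply/qpi_eq; set x' := repr _; set y' := repr _.
have /qpi_eq Hx : qpi x' = qpi x by rewrite qpi_repr.
have /qpi_eq Hy : qpi y' = qpi y by rewrite qpi_repr.
case: (ideal_setP I) => _ [S0 SD] SM.
have -> : x' * y' - x * y = 1 *: ((x' - x) * y') + x * (y' - y).
  by rewrite scale1r mulrBl mulrBr addrA subrK.
by apply: SD; [apply: (SM _ _ _ Hx).2|apply: (SM _ _ _ Hy).1].
Qed.

Let qpi_scale k x : scale k (qpi x) = qpi (k *: x).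
Proof.
apply/qpi_eq; set x' := repr _.
have /qpi_eq Hx : qpi x' = qpi x by rewrite qpi_repr.
case: (ideal_setP I) => _ [S0 SD] SM.
by rewrite -scalerBr -[_ *: _]addr0; apply: SD.
Qed.

Let mulqA : associative mul.
Proof. by move=> x y z; rewrite -[x]qpi_repr -[y]qpi_repr -[z]qpi_repr !qpi_mul mulrA. Qed.
Let mul1q : left_id one mul.
Proof. by move=> x; rewrite -[x]qpi_repr !qpi_mul mul1r. Qed.
Let mulq1 : right_id one mul.
Proof. by move=> x; rewrite -[x]qpi_repr !qpi_mul mulr1. Qed.
Let mulqDl : left_distributive mul +%R.
Proof.
move=> x y z; rewrite -[x]qpi_repr -[y]qpi_repr -[z]qpi_repr.
by rewrite !(qpi_mul, =^~ qpi_add) mulrDl.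
Qed.
Let mulqDr : right_distributive mul +%R.
Proof.
move=> x y z; rewrite -[x]qpi_repr -[y]qpi_repr -[z]qpi_repr.
by rewrite !(qpi_mul, =^~ qpi_add) mulrDr.
Qed.
Let oneq_neq0 : one != 0.
Proof.
apply/eqP; rewrite -[0]qpi_repr => /qpi_eq.
have /qpi_eq : qpi (repr (0 : algebra_quot)) = qpi 0 by rewrite qpi_repr /qpi piE.
case: (ideal_setP I) => _ [S0 SD] _; rewrite subr0 => H H1.
apply: (@ideal_set1 I).
by rewrite -[1](subrK (repr (0 : algebra_quot))) -[1 - _]scale1r; apply: SD.
Qed.
HB.instance Definition _ := GRing.Zmodule_isNzRing.Build algebra_quot
  mulqA mul1q mulq1 mulqDl mulqDr oneq_neq0.

Let scaleqA a b v : scale a (scale b v) = scale (a * b) v.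
Proof. by rewrite -[v]qpi_repr !qpi_scale scalerA. Qed.
Let scale1q : left_id 1 scale.
Proof. by move=> x; rewrite -[x]qpi_repr !qpi_scale scale1r. Qed.
Let scaleqDr : right_distributive scale +%R.
Proof.
move=> k x y; rewrite -[x]qpi_repr -[y]qpi_repr.
by rewrite !(qpi_scale, =^~ qpi_add) scalerDr.
Qed.
Let scaleqDl v : {morph scale^~ v : a b / a + b}.
Proof.
by move=> a b; rewrite -[v]qpi_repr !(qpi_scale, =^~ qpi_add) scalerDl.
Qed.
HB.instance Definition _ := GRing.Zmodule_isLmodule.Build F algebra_quot
  scaleqA scale1q scaleqDr scaleqDl.

Let scaleqAl (k : F) (x y : algebra_quot) : k *: (x * y) = k *: x * y.
Proof.
rewrite -[x]qpi_repr -[y]qpi_repr /GRing.scale /= /GRing.mul /=.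
by rewrite !(qpi_scale, qpi_mul) scalerAl.
Qed.
HB.instance Definition _ := GRing.Lmodule_isLalgebra.Build F algebra_quot scaleqAl.
Let scaleqAr (k : F) (x y : algebra_quot) : k *: (x * y) = x * (k *: y).
Proof.
rewrite -[x]qpi_repr -[y]qpi_repr /GRing.scale /= /GRing.mul /=.
by rewrite !(qpi_scale, qpi_mul) scalerAr.
Qed.
HB.instance Definition _ := GRing.Lalgebra_isAlgebra.Build F algebra_quot scaleqAr.

(** [A] carries no inversion, so the quotient receives one by classical choice; a non-unit is its
    own default inverse, as [invq_out] demands. Later computations with [^-1] take place in such
    quotients. *)
Let inverses (x : algebra_quot) : set algebra_quot := [set y | y * x = 1 /\ x * y = 1].
Let unitq : pred algebra_quot := fun x => `[< inverses x !=set0 >].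
Let invq (x : algebra_quot) : algebra_quot := xget x (inverses x).
Let mulVq : {in unitq, left_inverse 1 invq *%R}.
Proof. by move=> x /asboolP/(xgetPex x)[]. Qed.
Let mulqV : {in unitq, right_inverse 1 invq *%R}.
Proof. by move=> x /asboolP/(xgetPex x)[]. Qed.
Let unitqP x y : y * x = 1 /\ x * y = 1 -> unitq x.
Proof. by move=> H; apply/asboolP; exists y. Qed.
Let invq_out : {in [predC unitq], invq =1 id}.
Proof.
move=> x /asboolP H; apply: xgetPN => y Hy; apply: H; by exists y.
Qed.
HB.instance Definition _ := GRing.NzRing_hasMulInverse.Build algebra_quot
  mulVq mulqV unitqP invq_out.

Definition quot_pi (x : A) : algebra_quot := qpi x.

Fact quot_pi_zmod : zmod_morphism quot_pi.
Proof. by move=> x y; rewrite /quot_pi /qpi !piE. Qed.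
HB.instance Definition _ := GRing.isZmodMorphism.Build A algebra_quot quot_pi quot_pi_zmod.
Fact quot_pi_monoid : monoid_morphism quot_pi.
Proof. by split=> // x y; rewrite /quot_pi -qpi_mul. Qed.
HB.instance Definition _ := GRing.isMonoidMorphism.Build A algebra_quot quot_pi quot_pi_monoid.
Fact quot_pi_scalable : scalable quot_pi.
Proof. by move=> k x; rewrite /quot_pi -qpi_scale. Qed.
HB.instance Definition _ := GRing.isScalable.Build F A algebra_quot *:%R quot_pi quot_pi_scalable.

Lemma quot_pi_surj (y : algebra_quot) : exists x, quot_pi x = y.
Proof. by exists (repr y); apply: qpi_repr. Qed.

Lemma quot_pi_ker x : quot_pi x = 0 <-> ideal_set I x.
Proof. by rewrite -[0](rmorph0 quot_pi); split=> [/qpi_eq|H]; [|apply/qpi_eq]; rewrite subr0. Qed.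
End AlgebraQuotient.

Lemma algebra_quotient (F : fieldType) (A : algType F) (I : set A) :
  is_ideal_of [set: A] I -> ~ I 1 ->
  exists (B : unitAlgType F) (f : {lrmorphism A -> B}),
    (forall y, exists x, f x = y) /\ (forall x, f x = 0 <-> I x).
Proof.
move=> HI I1; pose J := ProperTwoSidedIdeal HI I1.
exists (algebra_quot J), (@quot_pi F A J); split.
  exact: quot_pi_surj.
exact: quot_pi_ker.
Qed.

(** * Nilpotent elements and the Jacobson radical *)

Definition is_nilpotent (R : nzRingType) (x : R) : Prop := exists n, x ^+ n = 0.

Section Nilpotent.
Variable R : nzRingType.
Implicit Types x y : R.

(** The inverse is the geometric series in [- x]. *)
Lemma nilpotent_inv1D x : is_nilpotent x ->
  exists y, [/\ y * (1 + x) = 1, (1 + x) * y = 1 & y * x = x * y].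
Proof.
case=> n xn; pose y := \sum_(i < n) (- x) ^+ i.
have cy : GRing.comm x y.
  by apply: commr_sum => i _; apply/commrX/commrN/commr_refl.
have xy : (1 + x) * y = 1.
  have := subrX1 (- x) n; rewrite exprNn xn mulr0 sub0r -/y.
  by rewrite -opprD mulNr addrC => /oppr_inj.
by exists y; split=> //; rewrite -[RHS]xy mulrDr mulrDl mul1r mulr1 cy.
Qed.

Lemma nilpotent_mulC x y : is_nilpotent (x * y) -> is_nilpotent (y * x).
Proof.
case=> n xyn; exists n.+1.
have H k : (y * x) ^+ k.+1 = y * (x * y) ^+ k * x.
  elim: k => [|k IH]; first by rewrite expr1 expr0 mulr1.
  by rewrite exprS IH [in RHS]exprS !mulrA.
by rewrite H xyn mulr0 mul0r.
Qed.

Lemma nilpotent_exp x k : is_nilpotent (x ^+ k) -> is_nilpotent x.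
Proof. by case=> n; rewrite -exprM => H; exists (k * n)%N. Qed.

End Nilpotent.

Section Algebraic.
Variables (F : fieldType) (A : algType F).
Hypothesis A_alg : algebraic_algebra A.

(** Factor an annihilating polynomial as [q * 'X ^+ n] with [q.[0] != 0]; splitting off the constant
    term of [q] and dividing by it gives [a ^+ n = w * a ^+ n.+1] with [w] a polynomial in [a]. One
    more factor [a] keeps the exponent positive. *)
Lemma algebraic_pi_regular (a : A) :
  exists n w, a ^+ n.+1 = w * a ^+ n.+2 /\ a * w = w * a.
Proof.
have [p p0 pa] := A_alg a.
have [n [q q0 Dp]] := multiplicity_XsubC p 0.
move: q0; rewrite p0 /= rootE => q0; rewrite subr0 in Dp.
have : root (q - q.[0]%:P) 0 by rewrite rootE !hornerE subrr.
move=> /factor_theorem [r]; rewrite subr0 => Dq.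
have comm (s t : {poly F}) : horner_alg a s * horner_alg a t =
    horner_alg a t * horner_alg a s by rewrite -!rmorphM mulrC.
exists n, (- (q.[0]^-1 *: horner_alg a r)).
have cXa : horner_alg a 'X = a by apply: horner_algX.
split; last by rewrite mulrN mulNr -scalerAr -scalerAl -{1 4}cXa comm.
have H : q.[0] *: a ^+ n = - (horner_alg a r * a ^+ n.+1).
  have {}pa : horner_alg a (r * 'X ^+ n.+1 + q.[0]%:P * 'X ^+ n) = 0.
    by rewrite exprS mulrA -mulrDl -Dq subrK -Dp.
  apply/eqP; rewrite -addr_eq0 -[X in _ == X]pa.
  rewrite rmorphD /= !rmorphM /= !rmorphXn /= cXa.
  by rewrite horner_algC mulr_algl addrC.
have {}H : a ^+ n = - (q.[0]^-1 *: horner_alg a r) * a ^+ n.+1.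
  by rewrite mulNr -scalerAl -scalerN -H scalerA mulVf // scale1r.
by rewrite exprSr {1}H -mulrA -exprSr.
Qed.

(** The idempotent is [w ^+ n.+1 * a ^+ n.+1], with [w] from [algebraic_pi_regular]. It fixes
    [a ^+ n.+1], hence is nonzero when [a] is not nilpotent. Written as [c * a], it lies in every
    left ideal containing [a]. *)
Lemma algebraic_idempotent (a : A) : ~ is_nilpotent a ->
  exists c, [/\ (c * a) * (c * a) = c * a, c * a <> 0 & a * c = c * a].
Proof.
move=> an; have [n [w [Da aw]]] := algebraic_pi_regular a.
have H k : a ^+ n.+1 = w ^+ k * a ^+ (n.+1 + k).
  elim: k => [|k IH]; first by rewrite mul1r addn0.
  rewrite addnS -addSn exprD (exprSr w) -mulrA [w * _]mulrA -Da -exprD.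
  exact: IH.
have cw : GRing.comm a w by [].
pose c := w ^+ n.+1 * a ^+ n.
have Dc : c * a = w ^+ n.+1 * a ^+ n.+1 by rewrite /c -mulrA -exprSr.
have cX : a ^+ n.+1 * w ^+ n.+1 = w ^+ n.+1 * a ^+ n.+1.
  by apply: commrX; apply/commr_sym/commrX/commr_sym.
have ee : a ^+ n.+1 * (c * a) = a ^+ n.+1.
  by rewrite Dc mulrA cX -mulrA -exprD -H.
exists c; split.
- by rewrite {1 3}Dc -mulrA ee.
- by move=> c0; apply: an; exists n.+1; rewrite -ee c0 mulr0.
- by rewrite Dc /c mulrA (commrX _ cw) -mulrA -exprS.
Qed.

End Algebraic.

Section Jacobson.
Variable A : nzRingType.
Implicit Types (L M : set A) (x y : A).

Lemma left_ideal_full L : is_left_ideal L -> L 1 -> L = setT.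
Proof.
by move=> [_ _ LM] L1; rewrite predeqE => x; split=> // _; rewrite -[x]mulr1; apply: LM.
Qed.

Lemma maximal_left_ideal_exists L : is_left_ideal L -> ~ L 1 ->
  exists2 M, is_maximal_left_ideal M & L `<=` M.
Proof.
move=> HL L1.
pose P (X : set A) := X = set0 \/ [/\ is_left_ideal X, L `<=` X & ~ X 1].
have [Ch ChP totCh|M [PM maxM]] := @Zorn_bigcup A P.
  have [[X0 Ch0 HX0]|noX] := pselect (exists2 X, Ch X & X <> set0); last first.
    left; rewrite predeqE => x; split=> // -[X ChX Xx].
    by apply: noX; exists X => // X0; rewrite X0 in Xx.
  have good X x : Ch X -> X x -> [/\ is_left_ideal X, L `<=` X & ~ X 1].
    by move=> /ChP[->|].
  have [[X00 _ _] LX0 _] : [/\ is_left_ideal X0, L `<=` X0 & ~ X0 1].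
    by case: (ChP _ Ch0).
  right; split; last 2 first.
  - by move=> x /LX0 X0x; exists X0.
  - by move=> [X ChX X1]; case: (good _ _ ChX X1).
  split; first by exists X0.
  - move=> x y [X ChX Xx] [Y ChY Yy].
    have [[_ XD _] _ _] := good _ _ ChX Xx; have [[_ YD _] _ _] := good _ _ ChY Yy.
    have [XY|YX] := totCh _ _ ChX ChY.
      by exists Y => //; apply: YD => //; apply: XY.
    by exists X => //; apply: XD => //; apply: YX.
  - move=> a x [X ChX Xx]; exists X => //.
    by have [[_ _ XM] _ _] := good _ _ ChX Xx; apply: XM.
have {}PM : [/\ is_left_ideal M, L `<=` M & ~ M 1].
  case: PM => // M0; exfalso; apply: (maxM L); last by right; split.
  rewrite M0; split; first exact: sub0set.
  by case: HL => L0 _ _ /(_ 0 L0).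
case: PM => HM LM M1; exists M => //; split=> //.
  by move=> MT; apply: M1; rewrite MT.
move=> N HN MN; have [N1|N1] := pselect (N 1).
  by right; apply: left_ideal_full.
left; apply/seteqP; split=> // x Nx; apply: contrapT => Mx.
apply: (maxM N); last by right; split=> //; apply: subset_trans MN.
by split=> // /(_ x Nx).
Qed.

Lemma jacobson_left_ideal : is_left_ideal (@jacobson_radical A).
Proof.
split=> [M [[]]//|x y Jx Jy M HM|a x Jx M HM].
  by have [[_ MD _] _ _] := HM; apply: MD; [apply: Jx|apply: Jy].
by have [[_ _ MM] _ _] := HM; apply: MM; apply: Jx.
Qed.

(** If a maximal left ideal [M] misses [x], then [1 = m + a * x] with [m] in [M]; as [a * x] is
    nilpotent, [m = 1 - a * x] is invertible, and [M] is everything. *)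
Lemma jacobson_nil_left x : (forall a, is_nilpotent (a * x)) -> jacobson_radical x.
Proof.
move=> xnil M [HM MT maxM]; apply: contrapT => Mx.
pose N : set A := [set y | exists m a, M m /\ y = m + a * x].
have [M0 MD MM] := HM.
have HN : is_left_ideal N.
  split; first by exists 0, 0; rewrite mul0r addr0.
    move=> _ _ [m [a [Mm ->]]] [n [b [Mn ->]]].
    by exists (m + n), (a + b); rewrite mulrDl addrACA; split=> //; apply: MD.
  move=> c _ [m [a [Mm ->]]]; exists (c * m), (c * a).
  by rewrite mulrDr mulrA; split=> //; apply: MM.
have MN : M `<=` N by move=> m Mm; exists m, 0; rewrite mul0r addr0.
have [NM|NT] := maxM _ HN MN.
  by apply: Mx; rewrite -NM; exists 0, 1; rewrite mul1r add0r.
have : N 1 by rewrite NT.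
move=> [m [a [Mm D1]]]; apply: MT; apply: left_ideal_full => //.
have [y [y1 _ _]] := nilpotent_inv1D (xnil (- a)).
by rewrite -y1 D1 mulNr addrK; apply: MM.
Qed.

End Jacobson.

Section JacobsonAlgebraic.
Variables (F : fieldType) (A : algType F).
Hypothesis A_alg : algebraic_algebra A.
Local Notation J := (@jacobson_radical A).

(** A non-nilpotent [a * x] in the radical would give a nonzero idempotent [e] there. The left
    annihilator of [e] is proper and contains [1 - e], so some maximal left ideal contains both [e]
    and [1 - e]. *)
Lemma jacobsonP (x : A) : J x <-> forall a, is_nilpotent (a * x).
Proof.
split; last exact: jacobson_nil_left.
move=> Jx a; have [_ _ JM] := jacobson_left_ideal A.
move: (JM a _ Jx) => {Jx JM}; move: (a * x) => {a}x Jx.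
apply: contrapT => /(algebraic_idempotent A_alg) [c [ee e0 _]].
have {Jx}Je : J (c * x) by have [_ _ JM] := jacobson_left_ideal A; apply: JM.
move: (c * x) ee e0 Je => e ee e0 Je.
pose L : set A := [set y | y * e = 0].
have HL : is_left_ideal L.
  split=> [|y z|a y]; rewrite /L /= ?mul0r //.
    by rewrite mulrDl => -> ->; rewrite addr0.
  by rewrite -mulrA => ->; rewrite mulr0.
have L1 : ~ L 1 by rewrite /L /= mul1r.
have [M HM LM] := maximal_left_ideal_exists HL L1.
have Me : M e by apply: Je.
have [HM' MT _] := HM; have [_ MD _] := HM'.
apply: MT; apply: left_ideal_full => //.
rewrite -[1](subrK e); apply: MD => //; apply: LM.
by rewrite /L /= mulrBl mul1r ee subrr.
Qed.

Lemma jacobson_nil x : J x -> is_nilpotent x.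
Proof. by move/jacobsonP/(_ 1); rewrite mul1r. Qed.

(** Closure on the right comes from the nil criterion: [a * x * b] is nilpotent because [b * a * x]
    is. *)
Lemma jacobson_ideal : is_ideal_of [set: A] J.
Proof.
have [J0 JD JM] := jacobson_left_ideal A.
split=> //.
  by split=> // k x y Jx Jy; apply: JD => //; rewrite -mulr_algl; apply: JM.
move=> b x _ Jx; split; first exact: JM.
apply/jacobsonP => a; rewrite mulrA; apply: nilpotent_mulC; rewrite mulrA.
exact: (jacobsonP x).1.
Qed.

Lemma jacobson_proper : ~ J 1.
Proof. by move/jacobson_nil=> [n]; rewrite expr1n => /eqP; rewrite oner_eq0. Qed.

End JacobsonAlgebraic.

(** * Normal subgroups of the group of units *)

Section CommutingTriple.
Variable R : nzRingType.

Lemma comm_horner_morph (S : nzRingType) (f : {rmorphism S -> R}) (u v : R)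
    (cfu : commr_rmorph f u) (p : {poly S}) :
  GRing.comm v u -> (forall s, GRing.comm v (f s)) ->
  GRing.comm v (horner_morph cfu p).
Proof.
move=> vu vf; elim/poly_ind: p => [|p c IH]; first by rewrite rmorph0; apply: commr0.
rewrite rmorphD rmorphM /= horner_morphX horner_morphC.
by apply: commrD => //; apply: commrM.
Qed.

(** Moves identities between three commuting elements of a noncommutative ring into a commutative
    polynomial ring, where [ring] proves them. *)
Lemma commuting_triple_morphism (x y z : R) :
  GRing.comm y x -> GRing.comm z x -> GRing.comm z y ->
  exists f : {rmorphism {poly {poly {poly int}}} -> R},
    [/\ f 'X%:P%:P = x, f 'X%:P = y & f 'X = z].
Proof.
move=> yx zx zy.
have cx : commr_rmorph intr x by move=> k; apply: commr_int.
have cy : commr_rmorph (horner_morph cx) y.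
  by move=> p; apply: comm_horner_morph => // k; apply: commr_int.
have cz : commr_rmorph (horner_morph cy) z.
  move=> p; apply: comm_horner_morph => // q.
  by apply: comm_horner_morph => // k; apply: commr_int.
exists (horner_morph cz); split.
- by rewrite /= horner_morphC /= horner_morphC /= horner_morphX.
- by rewrite /= horner_morphC /= horner_morphX.
- by rewrite /= horner_morphX.
Qed.

End CommutingTriple.

Section Commutators.
Variable R : unitRingType.
Implicit Types a m z t mu : R.

(* With P, Q, S, T = t + m, t + z m, t + z^2 m, t + z^3 m one has aP = Qa,
   aQ = Sa, aS = Ta, so conjugating P/Q by a gives Q^2 = mu P S and then
   S^2 = mu Q T; eliminating mu leaves a polynomial relation in t, m, z. *)
Lemma class_two_commutator a m z t mu :
  a \is a GRing.unit -> a * m = z * m * a ->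
  GRing.comm a z -> GRing.comm m z -> GRing.comm t a -> GRing.comm t z ->
  GRing.comm t m -> t + m \is a GRing.unit ->
  a * ((t + m) / (t + z * m)) = mu * ((t + m) / (t + z * m)) * a ->
  GRing.comm a mu ->
  (z - 1) ^+ 3 * (t * m * (t ^+ 2 - z ^+ 3 * m ^+ 2)) = 0.
Proof.
move=> Ua am az mz ta tz tm UP.
set P := t + m; set Q := t + z * m.
pose S := t + z ^+ 2 * m; pose T := t + z ^+ 3 * m.
have azn n : a * z ^+ n = z ^+ n * a by apply: commrX.
have aP : a * P = Q * a by rewrite mulrDr mulrDl am -ta.
have aQ : a * Q = S * a.
  by rewrite mulrDr mulrDl -ta mulrA az -mulrA am !mulrA.
have aS : a * S = T * a.
  by rewrite mulrDr mulrDl -ta mulrA azn -mulrA am !mulrA -exprSr.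
have conjU u v : u \is a GRing.unit -> a * u = v * a -> v \is a GRing.unit.
  by move=> Uu auv; rewrite -(unitrMl _ Ua) -auv unitrMr.
have UQ : Q \is a GRing.unit by apply: conjU aP.
have US : S \is a GRing.unit by apply: conjU aQ.
have [f [ft fm fz]] := commuting_triple_morphism (commr_sym tm) (commr_sym tz) (commr_sym mz).
have fP : f ('X%:P%:P + 'X%:P) = P by rewrite rmorphD ft fm.
have fQ : f ('X%:P%:P + 'X * 'X%:P) = Q by rewrite rmorphD rmorphM ft fm fz.
have fS : f ('X%:P%:P + 'X ^+ 2 * 'X%:P) = S.
  by rewrite rmorphD rmorphM rmorphXn ft fm fz.
have fT : f ('X%:P%:P + 'X ^+ 3 * 'X%:P) = T.
  by rewrite rmorphD rmorphM rmorphXn ft fm fz.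
move=> aq amu.
have aV : a * Q^-1 = S^-1 * a.
  by apply: (mulrI US); rewrite !mulrA -aQ divrr // mul1r mulrK.
have QS : Q / S = mu * (P / Q).
  by apply: (mulIr Ua); rewrite -aq mulrA aP -!mulrA -aV.
have PQ : P * Q = Q * P by rewrite -fP -fQ -!rmorphM mulrC.
have SQ : S * Q = Q * S by rewrite -fS -fQ -!rmorphM mulrC.
have E1 : Q * Q = mu * (P * S).
  transitivity (Q / S * (S * Q)); first by rewrite mulrA divrK.
  by rewrite QS SQ -!mulrA (mulKr UQ).
have E2 : S * S = mu * (Q * T).
  apply: (mulIr Ua); rewrite -mulrA -aQ mulrA -aQ -mulrA E1.
  by rewrite mulrA amu -!mulrA [a * (P * S)]mulrA aP -!mulrA aS.
have E3 : Q * Q * (Q * T) = S * S * (P * S).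
  rewrite E1 E2 -[LHS]mulrA -[RHS]mulrA; congr (_ * _).
  by rewrite -fP -fQ -fS -fT -!rmorphM; congr (f _); ring.
have <- : Q * Q * (Q * T) - S * S * (P * S) = 0 by rewrite E3 subrr.
rewrite -fP -fQ -fS -fT -ft -fm -fz -(rmorph1 f).
rewrite -!(rmorphM, rmorphB, rmorphXn); congr (f _); ring.
Qed.
End Commutators.

Lemma is_subspace_closed (F : fieldType) (A : algType F) (E : set A) : is_subspace E ->
  [/\ forall x y, E x -> E y -> E (x + y), forall x y, E x -> E y -> E (x - y)
    & forall (k : F) x, E x -> E (k *: x)].
Proof.
case=> E0 ED; have EZ (k : F) x : E x -> E (k *: x).
  by move=> Ex; rewrite -[_ *: _]addr0; apply: ED.
split=> // x y Ex Ey; first by rewrite -[x]scale1r; apply: ED.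
by rewrite addrC -scaleN1r; apply: ED.
Qed.

Section ConjugationStable.
Variables (F : fieldType) (B : unitAlgType F).
Implicit Types (M N E : set B) (x g : B).

Definition pairwise_comm E := forall x y, E x -> E y -> x * y = y * x.

Definition conj_stable E := forall g x, g \is a GRing.unit -> E x -> E (g * x / g).

(* E is the part in N of the double centralizer of M. *)
Lemma commutative_normal_closure M N :
  is_ideal_of [set: B] N -> pairwise_comm M -> conj_stable M ->
  exists E, [/\ is_subspace E, pairwise_comm E, conj_stable E, E `<=` N
    & forall x, N x ->
        (forall c, (forall m, M m -> c * m = m * c) -> x * c = c * x) -> E x].
Proof.
move=> [_ [N0 ND] NM] Mc Mg.
pose C : set B := [set c | forall m, M m -> c * m = m * c].
pose E : set B := [set x | N x /\ forall c, C c -> x * c = c * x].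
have stab g c m : g \is a GRing.unit -> c * (g^-1 * m * g) = (g^-1 * m * g) * c ->
    (g * c / g) * m = m * (g * c / g).
  move=> Ug H; apply: (mulrI (_ : g^-1 \is a GRing.unit)); first by rewrite unitrV.
  rewrite !mulrA mulVr // mul1r; apply: (mulIr Ug).
  by rewrite -!mulrA mulVr // mulr1 !mulrA -[c / g * m * g]mulrA -!mulrA in H * .
have Cg : conj_stable C.
  move=> g c Ug Cc m Mm; apply: stab => //; apply: Cc.
  by have := Mg g^-1 m; rewrite unitrV invrK; apply.
exists E; split.
- split; first by split=> // c _; rewrite mul0r mulr0.
  move=> k x y [Nx Hx] [Ny Hy]; split; first exact: ND.
  by move=> c Cc; rewrite mulrDl mulrDr -scalerAl -scalerAr Hx ?Hy.
- by move=> x y [_ Hx] [_ Hy]; apply: Hx => m Mm; apply: Hy => m' Mm'; apply: Mc.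
- move=> g x Ug [Nx Hx]; split.
    by apply: (NM g^-1 _ _ _).2 => //; apply: (NM g _ _ _).1.
  move=> c Cc; apply: stab => //; apply: Hx.
  by have := Cg g^-1 c; rewrite unitrV invrK; apply.
- by move=> x [].
- by move=> x Nx Hx; split.
Qed.

(** Put [d = [r, x]]. Conjugating [x] by [k%:A + r] and subtracting [x] puts [d / (k%:A + r)] in
    [E]. Subtracting the cases [k = t] and [k = s] gives a nonzero multiple of [p], so [p] is in
    [E], and then so is [p * r]. As [p] and [p * r] commute with [x], [p * d = 0], whence
    [p * p = 0]. *)
Lemma conj_difference_square0 E x r (t s : F) :
  is_subspace E -> pairwise_comm E -> conj_stable E -> E x -> t != s ->
  t%:A + r \is a GRing.unit -> s%:A + r \is a GRing.unit ->
  let p := (r * x - x * r) / (t%:A + r) / (s%:A + r) in E p /\ p * p = 0.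
Proof.
move=> Esub Ec Eg Ex ts Uu Uv.
have [ED EB EZ] := is_subspace_closed Esub.
have conjD k : k%:A + r \is a GRing.unit -> E ((r * x - x * r) / (k%:A + r)).
  move=> Uk; have := EB _ _ (Eg _ _ Uk Ex) Ex; congr E.
  rewrite -[X in _ - X](mulrK Uk) -mulrBl; congr (_ / _).
  by rewrite mulrDl mulrDr mulr_algl mulr_algr opprD addrACA subrr add0r.
have Et := conjD _ Uu; have Es := conjD _ Uv => {conjD}.
set u := t%:A + r in Uu Et *; set v := s%:A + r in Uv Es *.
set d := r * x - x * r in Et Es *; move=> p.
have uv : u * v = v * u.
  rewrite /u /v !(mulrDl, mulrDr) !mulr_algl !mulr_algr !scalerA [s * t]mulrC.
  by rewrite -!addrA; congr (_ + _); rewrite addrCA.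
have pv : p * v = d / u by rewrite /p divrK.
have pu : p * u = d / v.
  by rewrite /p -[_ / v * u]mulrA -(commrV uv) mulrA divrK.
have Ep : E p.
  have : E ((s - t)^-1 *: (p * v - p * u)) by apply: EZ; rewrite pv pu; apply: EB.
  congr E; rewrite -mulrBr opprD addrACA subrr addr0 -scalerBl mulr_algr scalerA.
  by rewrite mulVf ?scale1r // subr_eq0 eq_sym.
have Epr : E (p * r).
  have : E (p * v - s *: p) by rewrite pv; apply: EB => //; apply: EZ.
  by congr E; rewrite mulrDr mulr_algr addrAC subrr add0r.
have pd : p * d = 0.
  by rewrite mulrBr !mulrA (Ec _ _ Epr Ex) mulrA (Ec _ _ Ex Ep) subrr.
by split=> //; rewrite {2}/p !mulrA pd !mul0r.
Qed.

End ConjugationStable.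

(** Instance of [class_two_commutator] in which [mu] is a commutator of two elements of [M], hence
    commutes with [a]. *)
Lemma class_two_normal (B : unitRingType) (M : set B) (t a m : B) :
  (forall x, M x -> x \is a GRing.unit) ->
  (forall x y, M x -> M y -> M (x / y)) ->
  (forall g x, g \is a GRing.unit -> M x -> M (g * x / g)) ->
  (forall x y z, M x -> M y -> M z -> GRing.comm z (x * y / x / y)) ->
  M a -> M m -> GRing.comm t a -> GRing.comm t m -> t + m \is a GRing.unit ->
  let z := a * m / a / m in
  (z - 1) ^+ 3 * (t * m * (t ^+ 2 - z ^+ 3 * m ^+ 2)) = 0.
Proof.
move=> MU MV MJ Mc Ma Mm ta tm UP z.
have [Ua Um] := (MU _ Ma, MU _ Mm).
have am : a * m = z * m * a by rewrite /z !divrK.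
have aQ : a * (t + m) / a = t + z * m.
  by rewrite mulrDr -ta am -mulrDl mulrK.
have Mq : M ((t + m) / (t + z * m)).
  (* This quotient is the commutator of [t + m] and [a]. Normality puts it in [M], although [t + m]
     need not belong to [M]. *)
  have -> : (t + m) / (t + z * m) = (t + m) * a / (t + m) / a.
    have UaP : a * (t + m) \is a GRing.unit by rewrite unitrMl.
    by rewrite -aQ !invrM ?unitrV // invrK !mulrA.
  by apply: MV => //; apply: MJ.
pose mu := a * ((t + m) / (t + z * m)) / a / ((t + m) / (t + z * m)).
have tz : GRing.comm t z.
  exact: commrM (commrM (commrM ta tm) (commrV ta)) (commrV tm).
apply: (@class_two_commutator _ a _ _ _ mu) => //.
- exact: Mc.
- exact: Mc.
- by rewrite /mu (divrK (MU _ Mq)) divrK.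
- exact: Mc.
Qed.

(** Abstracts the derived series of the group of units. These closure properties, unlike equality
    with the derived series, pass to images in a quotient and to intersections with [1 + N]. *)
Definition unit_chain (B : unitRingType) (n : nat) (M : nat -> set B) : Prop :=
  [/\ forall k x, M k x -> x \is a GRing.unit,
      forall k x y, M k x -> M k y -> M k (x / y),
      forall k g x, g \is a GRing.unit -> M k x -> M k (g * x / g),
      forall k x y, M k x -> M k y -> M k.+1 (x * y / x / y)
    & forall x, M n x -> x = 1].

(** * Reduced algebraic algebras with solvable group of units *)

Section Reduced.
Variables (F : fieldType) (B : unitAlgType F).
Hypothesis B_alg : algebraic_algebra B.
Hypothesis B_red : forall x : B, x * x = 0 -> x = 0.
Implicit Types x y b f : B.

Lemma reduced_nilpotent x : is_nilpotent x -> x = 0.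
Proof.
case; elim=> [|[|n] IH]; first by rewrite expr0 => x1; rewrite -[x]mulr1 x1 mulr0.
  by rewrite expr1.
move=> xn; apply/IH/B_red.
by rewrite -exprD addnS -addSn exprD xn mul0r.
Qed.

(** Both [f * x * (1 - f)] and [(1 - f) * x * f] have square zero. *)
Lemma reduced_idempotent_central f x : f * f = f -> f * x = x * f.
Proof.
move=> ff.
have e1 : f * x * (1 - f) = 0.
  apply: B_red; rewrite !mulrA -[_ * (1 - f) * f]mulrA mulrBl mul1r ff subrr.
  by rewrite mulr0 !mul0r.
have e2 : (1 - f) * x * f = 0.
  apply: B_red; rewrite !mulrA -[_ * f * (1 - f)]mulrA mulrBr mulr1 ff subrr.
  by rewrite mulr0 !mul0r.
move/eqP: e1; rewrite mulrBr mulr1 subr_eq0 => /eqP ->.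
by move/eqP: e2; rewrite -mulrA mulrBl mul1r mulrA subr_eq0 => /eqP ->.
Qed.

(** With [w] from [algebraic_pi_regular], [b * (1 - w * b)] is nilpotent, hence zero. So
    [f = 1 - w * b] is an idempotent killed by [b], and [w * (1 - f) + f] inverts [b + f]. *)
Lemma reduced_split b : exists f,
  [/\ f * f = f, b * f = 0, b + f \is a GRing.unit & forall x, f * x = x * f].
Proof.
have [n [w [Db bw]]] := algebraic_pi_regular B_alg b.
have cb : GRing.comm b (1 - w * b).
  apply: commrB; first exact: commr1.
  by apply: commrM => //.
have wbb : b * (1 - w * b) = 0.
  apply: reduced_nilpotent; exists n.+1; rewrite exprMn_comm //.
  rewrite (exprS (1 - _)) mulrA -(commrX _ (commr_sym cb)).
  by rewrite mulrBl mul1r -mulrA -exprS -Db subrr mul0r.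
pose f := 1 - w * b.
have bf : b * f = 0 by [].
have fb : f * b = 0 by rewrite -[LHS]cb.
have ff : f * f = f by rewrite {1}/f mulrBl mul1r -mulrA bf mulr0 subr0.
have fC x : f * x = x * f by apply: reduced_idempotent_central.
have wb : w * b = 1 - f by rewrite /f opprB addrC subrK.
clearbody f; have [e [fe ef be eb] ee] : exists2 e, [/\ f * e = 0, e * f = 0, b * e = b & e * b = b]
    & w * b = e /\ e + f = 1.
  exists (1 - f); first by rewrite !(mulrBr, mulrBl) !(mulr1, mul1r) ff bf fb !subrr !subr0.
  by rewrite subrK.
exists f; split=> //; apply/unitrP; exists (w * e + f).
case: ee => {}wb ef1; split.
  by rewrite mulrDl !mulrDr ff fb -!mulrA eb ef wb mulr0 addr0 add0r.
by rewrite mulrDl !mulrDr ff bf !mulrA bw wb fC -mulrA fe mulr0 addr0 add0r -{1}wb -mulrA be wb.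
Qed.

Variable t0 : F.
Hypotheses (t00 : t0 != 0) (t01 : t0 != 1) (t0N1 : t0 != -1).

(** For [t != 0] the element [m + t%:A] may fail to be a unit, but it becomes one after adding the
    central idempotent [f] that it kills. On [f], [m] is the scalar [- t], so [z * f = f] and
    [h = (z - 1) ^+ 3] kills [f]. The relation of [class_two_normal] at [t%:A + f] then reduces to
    [t ^+ 2 *: h = h * (z ^+ 3 * m ^+ 2)]. Comparing [t = t0] with [t = 1] gives [h = 0], hence
    [z = 1]. *)
Lemma reduced_class_two (M : set B) a m :
  (forall x, M x -> x \is a GRing.unit) ->
  (forall x y, M x -> M y -> M (x / y)) ->
  (forall g x, g \is a GRing.unit -> M x -> M (g * x / g)) ->
  (forall x y z, M x -> M y -> M z -> GRing.comm z (x * y / x / y)) ->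
  M a -> M m -> a * m = m * a.
Proof.
move=> MU MV MJ Mc Ma Mm.
have [Ua Um] := (MU _ Ma, MU _ Mm).
pose z := a * m / a / m.
have mz : GRing.comm m z by apply: Mc.
have am : a * m = z * m * a by rewrite /z !divrK.
pose h := (z - 1) ^+ 3.
have mh : GRing.comm m h.
  by apply/commrX/commrB => //; apply: commr1.
have key (t : F) : t != 0 -> t ^+ 2 *: h = h * (z ^+ 3 * m ^+ 2).
  move=> tn0.
  have [f [ff mf UP fC]] := reduced_split (m + t%:A).
  have {}mf : m * f = - (t *: f).
    by apply/eqP; rewrite -addr_eq0 -mulr_algl -mulrDl mf.
  have zf : z * f = f.
    have : a * (m * f) = z * (m * f) * a by rewrite !mulrA am -!mulrA fC.
    rewrite mf !(mulrN, mulNr) -!(scalerAr, scalerAl) => /oppr_inj.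
    by move/(scalerI tn0) => H; apply: (mulIr Ua); rewrite -H fC.
  have hf : h * f = 0.
    by rewrite /h exprSr -mulrA mulrBl zf mul1r subrr mulr0.
  have hfm y : h * (f * y) = 0 by rewrite mulrA hf mul0r.
  have tfC y : GRing.comm (t%:A + f) y.
    by rewrite /GRing.comm mulrDl mulrDr mulr_algl mulr_algr fC.
  have := @class_two_normal B M (t%:A + f) a m MU MV MJ Mc Ma Mm (tfC _) (tfC _).
  rewrite [t%:A + f + m]addrC addrA -/z => /(_ UP) /=; rewrite -/h.
  clearbody h z.
  have htau y : h * ((t%:A + f) * y) = t *: (h * y).
    by rewrite mulrDl mulrDr hfm addr0 mulr_algl -scalerAr.
  rewrite -[_ * m * _]mulrA htau => /(congr1 ( *:%R t^-1)).
  rewrite scalerA mulVf // scale1r scaler0 mulrA -mh -mulrA.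
  move=> H; apply/eqP; rewrite -subr_eq0; apply/eqP; apply: (mulrI Um).
  rewrite mulr0 -[RHS]H; congr (_ * _); rewrite mulrBr expr2 htau.
  by rewrite -[t%:A + f]mulr1 htau mulr1 scalerA.
have h0 : h = 0.
  have : (t0 ^+ 2 - 1) *: h = 0.
    rewrite scalerBl key // scale1r -[h in X in _ - X]scale1r.
    by rewrite -[X in X *: h](expr1n _ 2) key ?oner_eq0 ?subrr.
  move/eqP; rewrite scaler_eq0 subr_sqr_1 mulf_eq0 subr_eq0 addr_eq0.
  by rewrite (negPf t01) (negPf t0N1) => /eqP.
have /eqP : z - 1 = 0 by apply: reduced_nilpotent; exists 3.
by rewrite subr_eq0 am => /eqP ->; rewrite mul1r.
Qed.

Lemma central_idempotent_unit (u g : B) (k : F) :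
  g * g = g -> (forall x, g * x = x * g) -> u \is a GRing.unit -> k != 0 ->
  u * (1 - g) + k *: g \is a GRing.unit.
Proof.
move=> gg gC Uu k0; apply/unitrP; exists (u^-1 * (1 - g) + k^-1 *: g).
have [e [[ge eg ee eC] De]] : exists e,
    [/\ g * e = 0, e * g = 0, e * e = e & forall x, e * x = x * e] /\ e = 1 - g.
  exists (1 - g); split=> //; split.
  - by rewrite mulrBr mulr1 gg subrr.
  - by rewrite mulrBl mul1r gg subrr.
  - by rewrite {1}mulrBl mul1r mulrBr mulr1 gg subrr subr0.
  - by move=> x; rewrite mulrBl mulrBr mul1r mulr1 gC.
rewrite -De.
have eg1 : e + g = 1 by rewrite De subrK.
split; rewrite mulrDl !mulrDr -!(scalerAl, scalerAr) gg !scalerA.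
  rewrite -!mulrA eg [g * (_ * _)]mulrA gC -mulrA ge [e * (u * e)]mulrA eC.
  by rewrite -mulrA ee mulKr // !mulr0 !scaler0 addr0 add0r mulVf // scale1r.
rewrite -!mulrA eg [g * (_ * _)]mulrA gC -mulrA ge [e * (_ * e)]mulrA eC.
by rewrite -mulrA ee mulVKr // !mulr0 !scaler0 addr0 add0r mulfV // scale1r.
Qed.

(** [g] is the sum of the spectral idempotents of [b] at 1 and [t0]. Removing the central part
    [b * g] keeps all commutators of [b], and the shifts by both scalars become units, as
    [conj_difference_square0] requires. *)
Lemma reduced_shift b : exists g, [/\ forall x, g * x = x * g,
    forall x, b * g * x = x * (b * g)
  & forall t, t = 1 \/ t = t0 -> (- t)%:A + (b - b * g) \is a GRing.unit].
Proof.
have Hsplit (t : F) : exists f, [/\ f * f = f, b * f = t *: f,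
    b - t%:A + f \is a GRing.unit & forall x, f * x = x * f].
  have [f [ff bf U C]] := reduced_split (b - t%:A); exists f; split=> //.
  by apply/eqP; rewrite -subr_eq0 -mulr_algl -mulrBl bf.
have [f1 [ff1 bf1 U1 C1]] := Hsplit 1; have [f2 [ff2 bf2 U2 C2]] := Hsplit t0.
have f12 : f1 * f2 = 0.
  have : (1 - t0) *: (f1 * f2) = 0.
    by rewrite scalerBl scalerAl -bf1 scalerAr -bf2 mulrA -C1 subrr.
  by move/eqP; rewrite scaler_eq0 subr_eq0 eq_sym (negPf t01) => /eqP.
pose g := f1 + f2.
have f21 : f2 * f1 = 0 by rewrite -C1.
have gg : g * g = g.
  by rewrite mulrDl !mulrDr ff1 ff2 f12 f21 addr0 add0r.
have gC x : g * x = x * g by rewrite mulrDl mulrDr C1 C2.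
have fg1 : f1 * g = f1 by rewrite mulrDr ff1 f12 addr0.
have fg2 : f2 * g = f2 by rewrite mulrDr ff2 f21 add0r.
exists g; split=> //.
  move=> x; rewrite mulrDr bf1 bf2 mulrDl mulrDr -!scalerAl -!scalerAr.
  by rewrite C1 C2.
have Hshift (t : F) f : t != 0 -> f * g = f -> b - t%:A + f \is a GRing.unit ->
    (- t)%:A + (b - b * g) \is a GRing.unit.
  move=> tn0 fg U; clearbody g.
  have := central_idempotent_unit gg gC U (_ : - t != 0); rewrite oppr_eq0.
  (* The shift equals [(b - t%:A + f) * (1 - g) + (- t) *: g], because [f * g = f]. *)
  move=> /(_ tn0); congr (_ \is a _).
  rewrite mulrBr mulr1 [(_ + f) * g]mulrDl fg [_ * g + f]addrC addrKA mulrBl mulr_algl !scaleNr.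
  by rewrite opprB -addrA [_ *: g - _ - _]addrAC subrr sub0r [RHS]addrC addrAC.
by move=> t [->|->]; [apply: (Hshift _ f1); rewrite ?oner_eq0|apply: (Hshift _ f2)].
Qed.

(** Descending induction shows that each [M k] is central: once [M k.+1] is, [M k] has class two, so
    it is commutative, and its closure [E] contains no nonzero square-zero element. Thus
    [conj_difference_square0] forces [[b, x] = 0]. At [k = 0] all units are central, and any element
    is a unit plus a central element. *)
Lemma reduced_solvable_units_comm n M :
  unit_chain n M -> (forall x, x \is a GRing.unit -> M 0%N x) ->
  forall x y, x * y = y * x.
Proof.
case=> MU MV MJ MC M1 M0.
have central j : forall k, (k + j)%N = n -> forall x, M k x -> forall b, x * b = b * x.
  elim: j => [k|j IH k Dn x Mx b].
    by rewrite addn0 => -> x /M1-> b; rewrite mul1r mulr1.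
  have {}IH : forall x, M k.+1 x -> forall b, x * b = b * x.
    by apply: IH; rewrite addSn -addnS.
  have Mc : pairwise_comm (M k).
    move=> a m; apply: reduced_class_two; [exact: MU|exact: MV|exact: MJ|].
    by move=> y z c My Mz _; apply/esym/IH/MC.
  have HT : is_ideal_of [set: B] setT by split.
  have [E [Esub Ec EJ _ HE]] := commutative_normal_closure HT Mc (MJ k).
  have Ex : E x by apply: HE => // c /(_ _ Mx).
  have [g [gC bgC Hr]] := reduced_shift b.
  have tt : - 1 != - t0 by rewrite eqr_opp eq_sym.
  have := conj_difference_square0 Esub Ec EJ Ex tt (Hr _ _) (Hr _ _).
  move=> /(_ (or_introl erefl) (or_intror erefl)) [_ /B_red].
  have U1 := Hr _ (or_introl erefl); have U2 := Hr _ (or_intror erefl).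
  move=> /(congr1 (fun y => y * _)) => /(_ ((- t0)%:A + (b - b * g))).
  rewrite mul0r divrK // => /(congr1 (fun y => y * ((- 1)%:A + (b - b * g)))).
  rewrite mul0r divrK // mulrBl mulrBr bgC.
  by move/eqP; rewrite opprD opprK addrACA addNr addr0 subr_eq0 => /eqP.
move=> x y; have [g [gC bgC Hr]] := reduced_shift x.
have /(central _ _ (add0n n) _)/(_ y) := M0 _ (Hr _ (or_introl erefl)).
rewrite !(mulrDl, mulrDr) mulr_algl mulr_algr => /addrI.
by rewrite mulNr mulrN bgC => /addIr.
Qed.

End Reduced.

(** * The linear group SL_2 among the units *)

Section MatrixUnits.
Variables (F : fieldType) (B : unitAlgType F) (X Y : B).
Hypotheses (XX : X * X = 0) (YY : Y * Y = 0).
Hypotheses (XYX : X * Y * X = X) (YXY : Y * X * Y = Y).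

(* The image of the matrix with rows (a, b), (c, d), where X and Y play the
   roles of the matrix units of indices (1, 2) and (2, 1). *)
Definition mx2_embed (a b c d : F) : B :=
  (1 - X * Y - Y * X) + a *: (X * Y) + b *: X + c *: Y + d *: (Y * X).

Lemma mx2_embed_mul a b c d a' b' c' d' :
  mx2_embed a b c d * mx2_embed a' b' c' d' =
  mx2_embed (a * a' + b * c') (a * b' + b * d') (c * a' + d * c') (c * b' + d * d').
Proof.
rewrite /mx2_embed; set e := X * Y; set f := Y * X; set w := 1 - e - f.
have [eX eY] : e * X = X /\ e * Y = 0 by rewrite /e XYX -mulrA YY mulr0.
have [fX fY] : f * X = 0 /\ f * Y = Y by rewrite /f YXY -mulrA XX mulr0.
have [Xe Xf] : X * e = 0 /\ X * f = X by rewrite /e /f !mulrA XX mul0r XYX.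
have [Ye Yf] : Y * e = Y /\ Y * f = 0 by rewrite /e /f !mulrA YY mul0r YXY.
have [ee ef] : e * e = e /\ e * f = 0 by rewrite {2}/e /f !mulrA eX eY mul0r.
have [fe ff] : f * e = 0 /\ f * f = f by rewrite /e {2}/f !mulrA fX fY mul0r.
have wl y : w * y = y - e * y - f * y by rewrite !mulrBl mul1r.
have wr y : y * w = y - y * e - y * f by rewrite !mulrBr mulr1.
have [we wX] : w * e = 0 /\ w * X = 0 by rewrite !wl ee fe eX fX !(subr0, subrr).
have [wY wf] : w * Y = 0 /\ w * f = 0 by rewrite !wl eY fY ef ff !(subr0, subrr).
have [ew Xw] : e * w = 0 /\ X * w = 0 by rewrite !wr ee ef Xe Xf !(subr0, subrr).
have [Yw fw] : Y * w = 0 /\ f * w = 0 by rewrite !wr Ye Yf fe ff !(subr0, subrr).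
have ww : w * w = w by rewrite {1}wl ew fw !subr0.
have XY : X * Y = e by []; have YX : Y * X = f by [].
clearbody e f w; rewrite !(mulrDl, mulrDr) -!scalerAl -!scalerAr !scalerA.
rewrite ?(ww, we, wX, wY, wf, ew, ee, eX, eY, ef, Xw, Xe, XX, XY, Xf).
rewrite ?(Yw, Ye, YX, YY, Yf, fw, fe, fX, fY, ff) !scaler0 !addr0 !add0r.
rewrite !scalerDl.
by rewrite [LHS](AC (1*2*2*2*2) (1*(2*4)*(3*5)*(6*8)*(7*9))).
Qed.

Lemma mx2_embed1 : mx2_embed 1 0 0 1 = 1.
Proof.
rewrite /mx2_embed !scale1r !scale0r !addr0.
by rewrite addrAC subrK subrK.
Qed.
End MatrixUnits.

Lemma invr_eq (R : unitRingType) (x y : R) :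
  x * y = 1 -> y * x = 1 -> x \is a GRing.unit /\ x^-1 = y.
Proof.
move=> xy yx; have Ux : x \is a GRing.unit by apply/unitrP; exists y.
by split=> //; apply: (mulrI Ux); rewrite mulrV.
Qed.

Section SpecialLinear.
Variables (F : fieldType) (B : unitAlgType F) (t0 : F).
Hypotheses (t00 : t0 != 0) (t01 : t0 != 1) (t0N1 : t0 != -1).
Variables (n : nat) (M : nat -> set B).
Hypothesis M_chain : unit_chain n M.
Hypothesis M0 : forall x, x \is a GRing.unit -> M 0%N x.

Lemma unit_chain_mul k x y : M k x -> M k y -> M k (x * y).
Proof.
case: M_chain => MU MV _ _ _ Mx My.
have M1 : M k 1 by rewrite -(mulrV (MU _ _ My)); apply: MV.
by have /(MV k x) : M k (1 / y) by [apply: MV]; rewrite div1r invrK; apply.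
Qed.

(** The elementary matrices survive in every [M k]: the commutator of [diag(t0, t0^-1)] with an
    elementary matrix rescales its parameter by [t0 ^+ 2 - 1] or [t0 ^- 2 - 1], both nonzero. In
    [M n] they are trivial, which forces [X = 0]. *)
Lemma unit_chain_matrix_units (X Y : B) :
  X * X = 0 -> Y * Y = 0 -> X * Y * X = X -> Y * X * Y = Y -> X = 0.
Proof.
case: (M_chain) => MU _ _ MC Mn XX YY XYX YXY.
pose phi := mx2_embed X Y.
have phiM a b c d a' b' c' d' : phi a b c d * phi a' b' c' d' =
    phi (a * a' + b * c') (a * b' + b * d') (c * a' + d * c') (c * b' + d * d').
  exact: mx2_embed_mul.
have phi1 : phi 1 0 0 1 = 1 by apply: mx2_embed1.
have Ualpha t : phi 1 t 0 1 \is a GRing.unit /\ (phi 1 t 0 1)^-1 = phi 1 (- t) 0 1.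
  by apply: invr_eq; rewrite phiM -phi1; congr phi; ring.
have Ubeta t : phi 1 0 t 1 \is a GRing.unit /\ (phi 1 0 t 1)^-1 = phi 1 0 (- t) 1.
  by apply: invr_eq; rewrite phiM -phi1; congr phi; ring.
have Udiag : phi t0 0 0 t0^-1 \is a GRing.unit /\
    (phi t0 0 0 t0^-1)^-1 = phi t0^-1 0 0 t0.
  by apply: invr_eq; rewrite phiM -phi1; congr phi; field.
have t02 : t0 ^+ 2 - 1 != 0.
  by rewrite subr_sqr_1 mulf_neq0 ?subr_eq0 ?addr_eq0.
have ind k : forall t, M k (phi 1 t 0 1) /\ M k (phi 1 0 t 1).
  elim: k => [|k IH] t; first by split; apply: M0; [case: (Ualpha t)|case: (Ubeta t)].
  have Mdiag : M k (phi t0 0 0 t0^-1).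
    (* The usual factorization of a diagonal matrix into two Weyl elements, with parameters [t0] and
       [- 1]. *)
    have -> : phi t0 0 0 t0^-1 =
        phi 1 t0 0 1 * phi 1 0 (- t0^-1) 1 * phi 1 t0 0 1 *
        (phi 1 (- 1) 0 1 * phi 1 0 1 1 * phi 1 (- 1) 0 1).
      by rewrite !phiM; congr phi; field.
    by do !apply: unit_chain_mul; apply: (IH _).1 || apply: (IH _).2.
  split.
    have := MC _ _ _ Mdiag (IH (t / (t0 ^+ 2 - 1))).1.
    rewrite Udiag.2 (Ualpha _).2 !phiM; congr (M _ (phi _ _ _ _)); by field; rewrite ?t00 ?t02.
  have := MC _ _ _ Mdiag (IH (t / (t0 ^- 2 - 1))).2.
  rewrite Udiag.2 (Ubeta _).2 !phiM; congr (M _ (phi _ _ _ _)); by field;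
    rewrite t00 mulN1r -opprB oppr_eq0 t02.
have := Mn _ (ind n 1).1; rewrite -phi1 /phi /mx2_embed.
by rewrite !scale0r !scale1r => /addIr/addIr H; apply: (addrI _ H).
Qed.

(** If [x * x = 0] and some [s * x] is not nilpotent, an idempotent [e = w * x] arises; [u = x * e]
    and a corrected [v = e * w] behave as matrix units, so [u = 0], and then [e = w * u = 0]. *)
Lemma solvable_units_reduced :
  algebraic_algebra B -> (forall x : B, (forall s, is_nilpotent (s * x)) -> x = 0) ->
  forall x : B, x * x = 0 -> x = 0.
Proof.
move=> B_alg B_semi x xx; apply: B_semi => s; apply: contrapT.
move=> /(algebraic_idempotent B_alg)[c [ee e0 _]].
pose w := c * s; have Dw : c * (s * x) = w * x by rewrite mulrA.
rewrite Dw in ee e0; set e := w * x in ee e0.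
pose u := x * e; pose v := e * w.
have vu : v * u = e by rewrite /u /v -mulrA [w * _]mulrA -/e ee.
have uu : u * u = 0.
  by rewrite /u {1}/e -!mulrA [x * (x * _)]mulrA xx mul0r !mulr0.
have uvu : u * v * u = u by rewrite -mulrA vu /u -mulrA ee.
have vuv : v * u * v = v by rewrite vu /v mulrA ee.
have u0 : u = 0.
  (* [v * v] need not vanish. Since [v * (u * v * v) = v * v], one has [v * Y = 0], and therefore
     [Y * Y = 0]. *)
  clearbody u v; pose Y := v - u * v * v.
  have uY : u * Y = u * v by rewrite /Y mulrBr !mulrA uu !mul0r subr0.
  have Yu : Y * u = v * u - u * v * (v * u) by rewrite /Y mulrBl -!mulrA.
  have vuvv : v * (u * v * v) = v * v by rewrite !mulrA vuv.
  apply: (@unit_chain_matrix_units u Y) => //.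
  - have vY : v * Y = 0 by rewrite /Y mulrBr vuvv subrr.
    by rewrite {1}/Y mulrBl -[u * v * v * Y]mulrA vY mulr0 subr0.
  - by rewrite uY uvu.
  - by rewrite Yu mulrBl -!mulrA uY [v * (u * v)]mulrA vuv mulrA.
by apply: e0; rewrite -ee {1}/e -mulrA -/u u0 mulr0.
Qed.
End SpecialLinear.

(** * Sums of square-zero ideals *)

Section RadStep.
Variables (F : fieldType).

Lemma smallest_subspace (A : algType F) (G : set A) :
  is_subspace (smallest (@is_subspace F A) G).
Proof.
split=> [S [[S0 _] _]//|k x y Hx Hy S HS].
by have [[_ SD] _] := HS; apply: SD; [apply: Hx|apply: Hy].
Qed.

(* The sum of the two-sided ideals whose square lies in I. *)
Definition rad_step (A : algType F) (I : set A) : set A :=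
  smallest (@is_subspace F A) [set x | forall b, I (x * b * x)].

Lemma rad_step_gen (A : algType F) (I : set A) x :
  (forall b, I (x * b * x)) -> rad_step I x.
Proof. by move=> Hx S [_]; apply. Qed.

Lemma rad_step_ideal (A : algType F) (I : set A) :
  is_ideal_of [set: A] I -> is_ideal_of [set: A] (rad_step I).
Proof.
move=> [_ [I0 ID] IM]; split=> //; first exact: smallest_subspace.
move=> b x _ Hx.
pose T : set A := [set y | rad_step I (b * y) /\ rad_step I (y * b)].
suff : T x by [].
apply: Hx; split.
  have [R0 RD] := @smallest_subspace A [set x | forall b, I (x * b * x)].
  split; first by rewrite /T /= mulr0 mul0r.
  move=> k y z [y1 y2] [z1 z2]; rewrite /T /= mulrDr mulrDl -scalerAl -scalerAr.
  by split; apply: RD.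
move=> y Hy; split; apply: rad_step_gen => c.
  by rewrite -!mulrA; apply: (IM b _ _ _).1; rewrite // !mulrA -(mulrA y).
rewrite !mulrA; apply: (IM b _ _ _).2; rewrite // -(mulrA y).
exact: Hy.
Qed.

Lemma sub_rad_step (A : algType F) (I : set A) :
  is_ideal_of [set: A] I -> I `<=` rad_step I.
Proof.
by move=> [_ _ IM] x Ix; apply: rad_step_gen => b; apply: (IM _ _ _ _).1.
Qed.

Lemma rad_step_mono (A : algType F) (I J : set A) :
  I `<=` J -> rad_step I `<=` rad_step J.
Proof. by move=> IJ; apply: sub_smallest2r; [exact: smallest_subspace|move=> x Hx b;
  apply/IJ/Hx]. Qed.

Lemma iter_rad_step_ideal (A : algType F) (I : set A) c :
  is_ideal_of [set: A] I -> is_ideal_of [set: A] (iter c (@rad_step A) I).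
Proof. by move=> HI; elim: c => //= c; apply: rad_step_ideal. Qed.

Lemma zero_ideal (A : algType F) : is_ideal_of [set: A] [set 0].
Proof.
split=> //; first by split=> // k x y -> ->; rewrite scaler0 addr0.
by move=> b x _ ->; rewrite mulr0 mul0r.
Qed.

Section Pull.
Variables (A B : algType F) (f : {lrmorphism A -> B}).
Hypothesis f_surj : forall y, exists x, f x = y.

(** Every lift of a generator is a generator, and the kernel of [f] consists of generators; hence
    all lifts of a linear combination are covered, whichever lift is chosen. *)
Lemma rad_step_preimage (K : set B) x : is_subspace K ->
  rad_step K (f x) -> rad_step (f @^-1` K) x.
Proof.
move=> [K0 KD] Hx.
have [R0 RD] := @smallest_subspace A [set x | forall b, (f @^-1` K) (x * b * x)].
have Rker y : f y = 0 -> rad_step (f @^-1` K) y.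
  by move=> fy; apply: rad_step_gen => b /=; rewrite !rmorphM /= fy !mul0r.
pose T : set B := [set y | forall x, f x = y -> rad_step (f @^-1` K) x].
suff : T (f x) by apply.
apply: Hx; split; last first.
  move=> y Hy z fz; apply: rad_step_gen => b /=.
  by rewrite !rmorphM /= fz; apply: Hy.
split; first exact: Rker.
move=> k y z Ty Tz x' fx'; have [y' fy] := f_surj y; have [z' fz] := f_surj z.
have -> : x' = 1 *: (x' - (k *: y' + z')) + (k *: y' + z') by rewrite scale1r subrK.
apply: (RD); last by apply: (RD); [apply: Ty|apply: Tz].
by apply: Rker; rewrite rmorphB rmorphD /= linearZ /= fy fz fx' subrr.
Qed.

Lemma iter_rad_step_preimage (I : set A) c x :
  (forall y, f y = 0 -> I y) ->
  iter c (@rad_step B) [set 0] (f x) -> iter c (@rad_step A) I x.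
Proof.
move=> kerI; elim: c x => [|c IH] x /=; first exact: kerI.
have [_ Ksub _] := iter_rad_step_ideal c (zero_ideal B).
by move/(rad_step_preimage Ksub); apply: rad_step_mono.
Qed.

End Pull.
End RadStep.

(** * Normal subgroups of [1 + N] for a nil ideal [N] *)

Section NilIdeal.
Variables (F : fieldType) (B : unitAlgType F) (N : set B).
Hypotheses (N_ideal : is_ideal_of [set: B] N) (N_nil : forall x, N x -> is_nilpotent x).
Local Notation rad c := (iter c (@rad_step F B) [set 0]).

Lemma nil_add_unit (k : F) x : k != 0 -> N x -> k%:A + x \is a GRing.unit.
Proof.
move=> k0 Nx; have /N_nil/nilpotent_inv1D [y [y1 y2 _]] : N (k^-1 *: x).
  by have [_ Nsub _] := N_ideal; have [_ _] := is_subspace_closed Nsub; apply.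
have -> : k%:A + x = k *: (1 + k^-1 *: x) by rewrite scalerDr scalerA mulfV // scale1r.
apply/unitrP; exists (k^-1 *: y).
by rewrite -!scalerAl -!scalerAr !scalerA y1 y2 mulVf // mulfV // scale1r.
Qed.

Lemma nil_1D_mul x y : N (x - 1) -> N (y - 1) -> N (x * y - 1).
Proof.
have [_ Nsub NM] := N_ideal; have [ND _ _] := is_subspace_closed Nsub.
move=> Nx Ny; have -> : x * y - 1 = (x - 1) * y + (y - 1).
  by rewrite mulrBl mul1r addrA subrK.
by apply: ND => //; apply: (NM _ _ _ _).2.
Qed.

Lemma nil_1D_exp x c : N (x - 1) -> N (x ^+ c - 1).
Proof.
move=> Nx; elim: c => [|c IH]; last by rewrite exprS; apply: nil_1D_mul.
by rewrite subrr; case: N_ideal => _ [].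
Qed.

(** Conjugating a square-zero [y] of [E] by [1 + y * s] yields [y + y * s * y], so [y * s * y] is in
    [E]. Commutativity of [E] then makes [x * y] generate a square-zero ideal. With [y] a conjugate
    of [x] this puts [x * g * x] in [rad 1] for every unit [g], hence [x * r * x] for every [r] in
    [N]. Two more layers reach [x * b * x] and [x]. *)
Lemma square_zero_rad (E : set B) x : is_subspace E -> pairwise_comm E ->
  conj_stable E -> E `<=` N -> E x -> x * x = 0 -> rad 3 x.
Proof.
move=> Esub Ec EJ EN Ex xx.
have [ED EB EZ] := is_subspace_closed Esub; have [_ Nsub NM] := N_ideal.
have rad_ideal c := iter_rad_step_ideal c (zero_ideal B).
have [_ rsub _] := rad_ideal 1%N; have [_ rB _] := is_subspace_closed rsub.
have Exsx y s : E y -> y * y = 0 -> E (y * s * y).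
  move=> Ey yy; have Ug : 1 + y * s \is a GRing.unit.
    rewrite -[1]scale1r; apply: nil_add_unit; rewrite ?oner_eq0 //.
    by apply: (NM _ _ _ _).2 => //; apply: EN.
  have : E ((1 + y * s) * y / (1 + y * s) - y) by apply: EB => //; apply: EJ.
  have gy : (1 + y * s) * y - y * (1 + y * s) = y * s * y.
    by rewrite mulrDl mul1r mulrDr mulr1 mulrA yy mul0r addr0 addrAC subrr add0r.
  congr E; rewrite -[X in _ - X](mulrK Ug) -mulrBl gy.
  by apply: (mulIr Ug); rewrite divrK // mulrDr mulr1 mulrA -(mulrA (y * s)) yy mulr0 mul0r addr0.
have prod y s : E y -> y * y = 0 -> x * y * s * (x * y) = 0.
  move=> Ey yy; have <- : y * ((x * s * x) * y) = x * y * s * (x * y).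
    by rewrite [in RHS](Ec _ _ Ex Ey) !mulrA -[RHS]mulrA (Ec _ _ Ey Ex) !mulrA.
  by rewrite -(Ec _ _ Ey (Exsx _ s Ex xx)) mulrA yy mul0r.
have xgx g : g \is a GRing.unit -> rad 1 (x * g * x).
  move=> Ug; have Ey := EJ _ _ Ug Ex.
  have yy : (g * x / g) * (g * x / g) = 0.
    by rewrite !mulrA divrK // -[g * x * x]mulrA xx mulr0 mul0r.
  have H : rad 1 (x * (g * x / g)) by apply: rad_step_gen => b; apply: prod.
  have [_ _ rM] := rad_ideal 1%N.
  by have := (rM g _ I H).2; rewrite !mulrA divrK.
have xNx r : N r -> rad 1 (x * r * x).
  move=> Nr; have := rB _ _ (xgx (1 + r) _) (xgx 1 (unitr1 _)).
  rewrite mulrDr mulrDl mulr1 addrAC subrr add0r; apply.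
  by rewrite -[1]scale1r; apply: nil_add_unit; rewrite ?oner_eq0.
apply: rad_step_gen => b; apply: rad_step_gen => b'.
have -> : x * b * x * b' * (x * b * x) = x * (b * x * b' * (x * b)) * x.
  by rewrite !mulrA.
apply: xNx; apply: (NM _ _ _ _).1 => //; apply: (NM _ _ _ _).2 => //; exact: EN.
Qed.

Variable t0 : F.
Hypotheses (t00 : t0 != 0) (t01 : t0 != 1) (t0N1 : t0 != -1).

(** Apply [conj_difference_square0] to [m - 1] with scalars 1 and [t0]: the square-zero element lies
    in [rad 3], and multiplying back by the two units recovers the commutator. *)
Lemma nil_commutative_rad (M : set B) m r : pairwise_comm M -> conj_stable M ->
  M m -> N (m - 1) -> N r -> rad 3 (r * m - m * r).
Proof.
move=> Mc MJ Mm Nm Nr.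
have [E [Esub Ec EJ EN HE]] := commutative_normal_closure N_ideal Mc MJ.
have Ex : E (m - 1).
  by apply: HE => // c /(_ _ Mm) cm; rewrite mulrBl mulrBr cm mul1r mulr1.
have U1 : 1%:A + r \is a GRing.unit by apply: nil_add_unit; rewrite ?oner_eq0.
have U2 : t0%:A + r \is a GRing.unit by apply: nil_add_unit.
have t10 : 1 != t0 by rewrite eq_sym.
have [Ep pp] := conj_difference_square0 Esub Ec EJ Ex t10 U1 U2.
have := square_zero_rad Esub Ec EJ EN Ep pp.
have [_ _ rM] := iter_rad_step_ideal 3 (zero_ideal B).
move=> /(rM (t0%:A + r) _ I) [_]; rewrite divrK // => /(rM (1%:A + r) _ I) [_].
rewrite divrK //; congr (rad 3).
by rewrite mulrBl mulrBr mul1r mulr1 opprB addrA subrK.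
Qed.

(** In the relation of [class_two_normal] at [t0%:A] the last factor is a nonzero scalar plus a
    nilpotent, up to units, so [(z - 1) ^+ 3 = 0]. As [e = z - 1] commutes with [N], [e * e] lies in
    [rad 1] and [e] in [rad 2]; finally [[a, m] = e * (m * a)]. *)
Lemma nil_class_two_rad (M : set B) a m :
  (forall x, M x -> x \is a GRing.unit) ->
  (forall x y, M x -> M y -> M (x / y)) -> conj_stable M ->
  (forall x, M x -> N (x - 1)) ->
  (forall x y r, M x -> M y -> N r -> r * (x * y / x / y) = x * y / x / y * r) ->
  M a -> M m -> rad 2 (a * m - m * a).
Proof.
move=> MU MV MJ MN Mc Ma Mm; pose z := a * m / a / m.
have [_ Nsub NM] := N_ideal; have [ND NB NZ] := is_subspace_closed Nsub.
have [Ua Um] := (MU _ Ma, MU _ Mm).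
have am : a * m = z * m * a by rewrite /z !divrK.
have Mc' x y c : M x -> M y -> M c -> GRing.comm c (x * y / x / y).
  move=> Mx My Mz; have := Mc _ _ _ Mx My (MN _ Mz).
  by rewrite mulrBl mulrBr mul1r mulr1 => /addIr.
have tC x : GRing.comm (t0%:A : B) x by rewrite /GRing.comm mulr_algl mulr_algr.
have Ut : t0%:A + m \is a GRing.unit.
  have -> : t0%:A + m = (t0 + 1)%:A + (m - 1).
    by rewrite scalerDl scale1r addrACA subrr addr0.
  by apply: nil_add_unit; [rewrite addr_eq0|apply: MN].
have MV1 x : M x -> M x^-1.
  by move=> Mx; rewrite -div1r; apply: (MV) => //; rewrite -(mulrV (MU _ Mx)); apply: MV.
have Nz : N (z - 1).
  by do !apply: nil_1D_mul; apply: MN => //; apply: MV1.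
have eta3 : (z - 1) ^+ 3 = 0.
  have := class_two_normal MU MV MJ Mc' Ma Mm (tC a) (tC m) Ut.
  rewrite -/z /= => H.
  have U : t0%:A * m * (t0%:A ^+ 2 - z ^+ 3 * m ^+ 2) \is a GRing.unit.
    rewrite unitrMl; first by rewrite mulr_algl scaler_unit ?unitfE.
    have -> : t0%:A ^+ 2 - z ^+ 3 * m ^+ 2 =
        (t0 ^+ 2 - 1)%:A + - (z ^+ 3 * m ^+ 2 - 1).
      by rewrite scalerBl scale1r opprB addrA subrK expr2 mulr_algl scalerA.
    apply: nil_add_unit; first by rewrite subr_sqr_1 mulf_neq0 ?subr_eq0 ?addr_eq0.
    rewrite -scaleN1r; apply: NZ; apply: nil_1D_mul; apply: nil_1D_exp => //.
    exact: MN.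
  by apply: (mulIr U); rewrite H mul0r.
have eC r : N r -> r * (z - 1) = (z - 1) * r.
  by move=> Nr; rewrite mulrBl mulrBr mul1r mulr1 Mc.
set e := z - 1 in Nz eta3 eC.
have eee : e * (e * e) = 0 by rewrite -eta3 !exprS expr0 mulr1.
have rI c := iter_rad_step_ideal c (zero_ideal B).
have Ne b : N (e * b) /\ N (b * e).
  by split; [apply: (NM _ _ _ _).2|apply: (NM _ _ _ _).1].
have r1 : rad 1 (e * e).
  apply: rad_step_gen => b.
  have -> : e * e * b * (e * e) = e * (e * b * e) * e by rewrite !mulrA.
  by rewrite (eC _ (Ne b).1) !mulrA -[e * e * e]mulrA eee !mul0r.
have r2 : rad 2 e.
  apply: rad_step_gen => b; rewrite -mulrA -(eC _ (Ne b).2) -mulrA.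
  by have [_ _ rM] := rI 1%N; exact: (rM _ _ I r1).1.
have [_ _ rM] := rI 2%N.
have -> : a * m - m * a = e * (m * a) by rewrite mulrBl mul1r mulrA -am.
exact: (rM _ _ I r2).2.
Qed.

End NilIdeal.

(** * The derived series of the group of units *)

Section DerivedSeries.
Variable G : groupType.

Lemma smallest_subgroup (S : set G) : is_subgroup (smallest (@is_subgroup G) S).
Proof.
split=> [H [[H1 _] _]//|x y Hx Hy H HH].
by have [[_ HD] _] := HH; apply: HD; [apply: Hx|apply: Hy].
Qed.

Lemma derived_series_subgroup k : is_subgroup (@derived_series G k).
Proof. by case: k => [|k]; [split|apply: smallest_subgroup]. Qed.

Lemma derived_series_comm k (x y : G) :
  derived_series k x -> derived_series k y -> derived_series k.+1 [~ x, y]%g.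
Proof. by move=> Hx Hy S [_]; apply; exists x => //; exists y. Qed.

Lemma derived_series_conj k (x g : G) :
  derived_series k x -> derived_series k (x ^ g)%g.
Proof.
elim: k x => [//|k IH] x Hx.
pose T : set G := [set y | derived_series k.+1 (y ^ g)%g].
suff : T x by [].
have [H1 HV] := derived_series_subgroup k.+1.
apply: Hx; split.
  split; first by rewrite /T /= conj1g.
  by move=> y z Hy Hz; rewrite /T /= conjMg conjVg; apply: HV.
move=> _ [y Hy [z Hz <-]]; rewrite /T /= conjRg.
by apply: derived_series_comm; apply: IH.
Qed.

Lemma subgroup_mul (H : set G) (x y : G) : is_subgroup H -> H x -> H y -> H (x * y)%g.
Proof.
move=> [H1 HV] Hx Hy; have /(HV x) : H (1 / y)%g by apply: HV.
by rewrite div1g invgK; apply.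
Qed.

Lemma subgroup_inv (H : set G) (x : G) : is_subgroup H -> H x -> H x^-1%g.
Proof. by move=> [H1 HV] Hx; rewrite -div1g; apply: HV. Qed.
End DerivedSeries.

Section UnitValue.
Variable A : nzRingType.
Implicit Types u v : ring_units A.

Definition uval u : A := (unit_pair u).1.
Definition uinv u : A := (unit_pair u).2.

Lemma uvalM u v : uval (u * v)%g = uval u * uval v. Proof. by []. Qed.
Lemma uvalV u : uval u^-1%g = uinv u. Proof. by []. Qed.
Lemma uval1 : uval 1%g = 1. Proof. by []. Qed.
Lemma uvalK u : uval u * uinv u = 1.
Proof. by case: u => -[a b] H; case/andP: (H) => /eqP. Qed.
Lemma uinvK u : uinv u * uval u = 1.
Proof. by case: u => -[a b] H; case/andP: (H) => _ /eqP. Qed.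
Lemma uval_inj u v : uval u = uval v -> u = v.
Proof.
move=> uv; apply: val_inj; rewrite /= [unit_pair u]surjective_pairing.
rewrite [unit_pair v]surjective_pairing; congr (_, _) => //.
change (uinv u = uinv v).
by rewrite -[uinv u]mulr1 -(uvalK v) -uv mulrA uinvK mul1r.
Qed.
Lemma uval_exists (a b : A) : a * b = 1 -> b * a = 1 -> exists u, uval u = a.
Proof.
move=> ab ba; have H : ((a, b).1 * (a, b).2 == 1) && ((a, b).2 * (a, b).1 == 1).
  by rewrite /= ab ba eqxx.
by exists (RingUnit H).
Qed.

Lemma uval_image (B : unitRingType) (f : {rmorphism A -> B}) u :
  f (uval u) \is a GRing.unit /\ f (uinv u) = (f (uval u))^-1.
Proof.
have [||Uu ->] := @invr_eq B (f (uval u)) (f (uinv u)) => //.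
  by rewrite -rmorphM uvalK rmorph1.
by rewrite -rmorphM uinvK rmorph1.
Qed.
End UnitValue.
Arguments uval {A} u.
Arguments uinv {A} u.

(** * Passing to quotients by ideals inside the radical *)

Section Quotient.
Variables (F : fieldType) (A : algType F).
Hypothesis A_alg : algebraic_algebra A.
Local Notation J := (@jacobson_radical A).

Lemma rad_step_jacobson (I : set A) : I `<=` J -> rad_step I `<=` J.
Proof.
move=> IJ; have [_ Jsub JM] := jacobson_ideal A_alg.
apply: smallest_sub => // x Hx; apply/(jacobsonP A_alg) => a.
apply: (@nilpotent_exp _ _ 2); apply: (jacobson_nil A_alg).
rewrite expr2 !mulrA -(mulrA (a * x)) -mulrA.
have := (JM a _ _ (IJ _ (Hx a))).1; by rewrite !mulrA; apply.
Qed.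

Lemma iter_rad_step_jacobson (I : set A) c : I `<=` J -> iter c (@rad_step F A) I `<=` J.
Proof. by move=> IJ; elim: c => //= c; apply: rad_step_jacobson. Qed.

Lemma one_add_jacobson_unit x : J x -> exists u : ring_units A, uval u = 1 + x.
Proof.
by move/(jacobson_nil A_alg)/nilpotent_inv1D => [y [y1 y2 _]]; apply: uval_exists y2 y1.
Qed.

(** Units lift because the kernel is nil: if [x] and [z] lift [y] and [y^-1], then [x * z] and
    [z * x] lie in [1 + J], hence are invertible, and so is [x]. *)
Lemma jacobson_quotient (I : set A) :
  is_ideal_of [set: A] I -> I `<=` J ->
  exists (B : unitAlgType F) (f : {lrmorphism A -> B}),
    [/\ forall y, exists x, f x = y, forall x, f x = 0 <-> I x,
        forall y, y \is a GRing.unit -> exists u : ring_units A, f (uval u) = y,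
        is_ideal_of [set: B] (f @` J) & forall y, (f @` J) y -> is_nilpotent y].
Proof.
move=> HI IJ; have HJ := jacobson_ideal A_alg.
have [B [f [f_surj f_ker]]] := algebra_quotient HI (contra_not (@IJ 1) (jacobson_proper A_alg)).
exists B, f; split=> //.
- move=> y Uy; have [x fx] := f_surj y; have [z fz] := f_surj y^-1.
  have inv a b : f a * f b = 1 -> exists c, a * b * c = 1 /\ c * (a * b) = 1.
    move=> H; have /f_ker/IJ Jab : f (a * b - 1) = 0.
      by rewrite rmorphB rmorphM rmorph1 /= H subrr.
    have [c [c1 c2 _]] := nilpotent_inv1D (jacobson_nil A_alg Jab).
    by exists c; rewrite -{1}[a * b](subrK 1) -{2}[a * b](subrK 1) [_ + 1]addrC.
  have [c [c1 _]] := inv x z (etrans (congr2 *%R fx fz) (mulrV Uy)).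
  have [d [_ d2]] := inv z x (etrans (congr2 *%R fz fx) (mulVr Uy)).
  have xr : x * (z * c) = 1 by rewrite mulrA.
  have xl : d * z * x = 1 by rewrite -mulrA.
  have [|u ux] := @uval_exists A x (z * c) xr.
    by rewrite -[z * c]mul1r -xl -(mulrA _ x) xr mulr1.
  by exists u; rewrite ux.
- have [_ [J0 JD] JM] := HJ; split=> //.
    split; first by exists 0; rewrite ?rmorph0.
    move=> k _ _ [x Jx <-] [y Jy <-]; exists (k *: x + y); first exact: JD.
    by rewrite rmorphD /= linearZ.
  move=> b _ _ [x Jx <-]; have [a <-] := f_surj b.
  by split; [exists (a * x)|exists (x * a)]; rewrite ?rmorphM //; case: (JM a x Logic.I Jx).
- move=> _ [x Jx <-]; have [m xm] := jacobson_nil A_alg Jx.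
  by exists m; rewrite -rmorphXn xm rmorph0.
Qed.

Lemma unit_chain_image (B : unitAlgType F) (f : {lrmorphism A -> B}) n :
  (forall y, y \is a GRing.unit -> exists u : ring_units A, f (uval u) = y) ->
  @derived_series (ring_units A) n = [set 1%g] ->
  unit_chain n (fun k => (f \o uval) @` (@derived_series (ring_units A) k)).
Proof.
move=> f_lift Dn; have fV u : f (uinv u) = (f (uval u))^-1 by case: (uval_image f u).
split.
- by move=> k _ [u _ <-]; case: (uval_image f u).
- move=> k _ _ [u Du <-] [v Dv <-]; exists (u / v)%g.
    exact: (derived_series_subgroup _ _).2.
  by rewrite /= uvalM uvalV rmorphM /= fV.
- move=> k g _ Ug [u Du <-]; have [w fw] := f_lift g Ug.
  exists (u ^ w^-1)%g; first exact: derived_series_conj.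
  by rewrite conjgE invgK /= !uvalM uvalV !rmorphM /= fV -fw mulrA.
(* The group commutator [[~ u, v]] is [u^-1 * v^-1 * u * v]; the inverses turn it into the form used
   by [unit_chain]. *)
- move=> k _ _ [u Du <-] [v Dv <-]; exists [~ u^-1, v^-1]%g.
    by apply: derived_series_comm; apply: subgroup_inv => //; apply: derived_series_subgroup.
  by rewrite commgEl conjgE !invgK /= !uvalM !uvalV !rmorphM /= !fV !mulrA.
- by move=> _ [u Du <-]; move: Du; rewrite Dn => ->; rewrite /= uval1 rmorph1.
Qed.

Lemma unit_chain_1D (B : unitAlgType F) (N : set B) n (M : nat -> set B) :
  is_ideal_of [set: B] N -> unit_chain n M ->
  unit_chain n (fun k => [set x | M k x /\ N (x - 1)]).
Proof.
move=> HN [MU MV MJ MC M1]; have [_ Nsub NM] := HN.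
have [ND NB _] := is_subspace_closed Nsub.
have N1V x : x \is a GRing.unit -> N (x - 1) -> N (x^-1 - 1).
  move=> Ux Nx; have -> : x^-1 - 1 = 0 - (x - 1) * x^-1.
    by rewrite mulrBl mulrV // mul1r sub0r opprB.
  by apply: NB; [case: Nsub|apply: (NM _ _ _ _).2].
split.
- by move=> k x [/MU].
- move=> k x y [Mx Nx] [My Ny]; split; first exact: MV.
  by apply: nil_1D_mul => //; apply: N1V => //; apply: MU My.
- move=> k g x Ug [Mx Nx]; split; first exact: MJ.
  have -> : g * x / g - 1 = g * (x - 1) / g by rewrite mulrBr mulr1 mulrBl mulrV.
  by apply: (NM _ _ _ _).2 => //; apply: (NM _ _ _ _).1.
- move=> k x y [Mx Nx] [My Ny]; split; first exact: MC.
  have [Ux Uy] := (MU _ _ Mx, MU _ _ My).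
  by do !apply: nil_1D_mul => //; apply: N1V.
- by move=> x [/M1].
Qed.

End Quotient.

(** Supplies the scalar [t0] with [t0 != 0] and [t0 ^+ 2 != 1] on which the matrix and radical
    arguments rest. *)
Lemma exists_scalar (F : fieldType) : (`I_4 #<= [set: F])%card ->
  exists t : F, [/\ t != 0, t != 1 & t != -1].
Proof.
move=> /card_leP [f]; apply: contrapT => H.
have mem t : t \in [:: 0; 1; -1 : F].
  rewrite !inE; apply: contra_notT H; rewrite !negb_or => /and3P[t1 t2 t3].
  by exists t.
pose g (i : 'I_4) : F := val ((f \o IIord^-1) i).
have g_inj : injective g.
  by move=> i j /val_inj; apply: (in2TT 'inj_(f \o IIord^-1)).
have := @uniq_leq_size _ (codom g) [:: 0; 1; -1 : F].
rewrite map_inj_uniq // enum_uniq size_codom card_ord => /(_ isT).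
by move=> /(_ (fun x _ => mem x)).
Qed.

(** * Consequences of solvability of the group of units *)

Section Forward.
Variables (F : fieldType) (A : algType F) (t0 : F).
Hypotheses (t00 : t0 != 0) (t01 : t0 != 1) (t0N1 : t0 != -1).
Hypothesis A_alg : algebraic_algebra A.
Variable n : nat.
Hypothesis Dn : @derived_series (ring_units A) n = [set 1%g].
Local Notation J := (@jacobson_radical A).
Local Notation D k := (@derived_series (ring_units A) k).
Local Notation rad c := (iter c (@rad_step F A)).

Lemma algebraic_image (B : algType F) (f : {lrmorphism A -> B}) :
  (forall y, exists x, f x = y) -> algebraic_algebra B.
Proof.
move=> f_surj y; have [x <-] := f_surj y; have [p p0 px] := A_alg x.
exists p => //; rewrite -(rmorph0 f) -px.
elim/poly_ind: {p0 px} p => [|p c IH]; first by rewrite !rmorph0.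
by rewrite !rmorphD !rmorphM /= IH !horner_algC !horner_algX rmorph_alg.
Qed.

Lemma commutator_jacobson x y : J (x * y - y * x).
Proof.
have HJ := jacobson_ideal A_alg.
have [B [f [f_surj f_ker f_lift _ _]]] := jacobson_quotient A_alg HJ (@subset_refl _ J).
have chain := unit_chain_image f_lift Dn.
have B_alg := algebraic_image f_surj.
have M0 z : z \is a GRing.unit -> ((f \o uval) @` (D 0)) z.
  by move=> /f_lift [u <-]; exists u.
(* Nilpotence modulo [J] is nilpotence, because [J] is nil. *)
have B_semi (z : B) : (forall s, is_nilpotent (s * z)) -> z = 0.
  have [a <-] := f_surj z => Hz; apply/f_ker/(jacobsonP A_alg) => s.
  have [m] := Hz (f s); rewrite -rmorphM -rmorphXn => /f_ker/(jacobson_nil A_alg).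
  exact: nilpotent_exp.
have B_red := solvable_units_reduced t00 t01 t0N1 chain M0 B_alg B_semi.
apply/f_ker; rewrite rmorphB !rmorphM /=; apply/eqP; rewrite subr_eq0; apply/eqP.
exact: (reduced_solvable_units_comm B_alg B_red t00 t01 t0N1 chain M0).
Qed.

(** The 5 is 2 + 3. Modulo [I] the units of [D k] in [1 + J] have commutators centralizing [J], so
    [nil_class_two_rad] makes them commute modulo [rad 2 I]; over that ideal [nil_commutative_rad]
    costs 3 further steps. *)
Lemma radical_commutator_step (I : set A) k :
  is_ideal_of [set: A] I -> I `<=` J ->
  (forall u r, D k.+1 u -> J (uval u - 1) -> J r -> I (r * uval u - uval u * r)) ->
  forall u r, D k u -> J (uval u - 1) -> J r -> rad 5 I (r * uval u - uval u * r).
Proof.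
move=> HI IJ Hk.
have HJ := jacobson_ideal A_alg.
have [_ Jsub _] := HJ; have [JD JB JZ] := is_subspace_closed Jsub.
have lift (K : set A) (B : unitAlgType F) (f : {lrmorphism A -> B}) u :
    K `<=` J -> (forall x, f x = 0 <-> K x) -> (f @` J) (f (uval u) - 1) -> J (uval u - 1).
  move=> KJ f_ker [x Jx fx]; rewrite -[_ - 1](subrK x); apply: JD => //.
  by apply: (KJ); apply/f_ker; rewrite !rmorphB rmorph1 /= fx subrr.
have comm2 u v : D k u -> D k v -> J (uval u - 1) -> J (uval v - 1) ->
    rad 2 I (uval u * uval v - uval v * uval u).
  move=> Du Dv Ju Jv.
  have [B [f [f_surj f_ker f_lift N_ideal N_nil]]] := jacobson_quotient A_alg HI IJ.
  have [MU MV MJ MC _] := unit_chain_1D N_ideal (unit_chain_image f_lift Dn).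
  pose M := [set x | ((f \o uval) @` (D k)) x /\ (f @` J) (x - 1)].
  have fJ w : J (uval w - 1) -> (f @` J) (f (uval w) - 1).
    by move=> Jw; exists (uval w - 1); rewrite // rmorphB rmorph1.
  have Mu : M (f (uval u)) by split; [exists u|apply: fJ].
  have Mv : M (f (uval v)) by split; [exists v|apply: fJ].
  have := @nil_class_two_rad F B _ N_ideal N_nil t0 t00 t01 t0N1 M _ _
    (MU k) (MV k) (MJ k) (fun x => @proj2 _ _) _ Mu Mv.
  rewrite -!rmorphM -rmorphB; move=> H; apply: iter_rad_step_preimage f_surj _ _ _ _ _.
    by move=> y /f_ker.
  apply: H => x y _ Mx My [r Jr <-].
  have [[w Dw <-] Nw] := MC _ _ _ Mx My.
  apply/eqP; rewrite -subr_eq0 /= -!rmorphM -rmorphB; apply/eqP/f_ker.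
  by apply: Hk => //; apply: lift IJ f_ker Nw.
move=> u r Du Ju Jr.
have HI2 := iter_rad_step_ideal 2 HI.
have IJ2 := iter_rad_step_jacobson A_alg (c := 2) IJ.
have [B [f [f_surj f_ker f_lift N_ideal N_nil]]] := jacobson_quotient A_alg HI2 IJ2.
have [_ _ MJ _ _] := unit_chain_1D N_ideal (unit_chain_image f_lift Dn).
have Ju' : (f @` J) (f (uval u) - 1).
  by exists (uval u - 1); rewrite // rmorphB rmorph1.
have := @nil_commutative_rad F B _ N_ideal N_nil t0 t00 t01 _ (f (uval u)) (f r) _ (MJ k) _ Ju'.
rewrite -!rmorphM -rmorphB; move=> H.
change (rad 3 (rad 2 I) (r * uval u - uval u * r)).
apply: iter_rad_step_preimage f_surj _ _ _ _ _; first by move=> y /f_ker.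
apply: H; last by exists r.
- move=> _ _ [[v Dv <-] Nv] [[w Dw <-] Nw].
  apply/eqP; rewrite -subr_eq0 /= -!rmorphM -rmorphB; apply/eqP/f_ker.
  by apply: comm2 => //; apply: lift IJ2 f_ker _.
- by split=> //; exists u.
Qed.

(** Descend from the trivial term [D n] to [D 0], five radical steps at a time; in [D 0] the unit
    [1 + y] has the same commutators as [y]. *)
Lemma jacobson_commutator_rad : exists c, forall x y, J x -> J y -> rad c [set 0] (x * y - y * x).
Proof.
have IJ : [set 0] `<=` J by move=> _ ->; case: (jacobson_ideal A_alg) => _ [].
have key j : forall k, (k + j)%N = n -> exists c, forall u r,
    D k u -> J (uval u - 1) -> J r -> rad c [set 0] (r * uval u - uval u * r).
  elim: j => [k|j IH k Dk].
    rewrite addn0 => ->; exists 0%N => u r; rewrite Dn => -> _ _.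
    by rewrite uval1 mulr1 mul1r subrr.
  have [|c Hc] := IH k.+1; first by rewrite addSn -addnS.
  exists (5 + c)%N => u r Du Ju Jr; rewrite iterD.
  apply: (@radical_commutator_step _ k) => //.
    exact: iter_rad_step_ideal (zero_ideal A).
  exact: iter_rad_step_jacobson.
have [c Hc] := key n 0%N (add0n n); exists c => x y Jx Jy.
have [u Du] := one_add_jacobson_unit A_alg Jy.
have := Hc u x; rewrite Du addrAC subrr add0r => /(_ _ Jy Jx).
by rewrite mulrDl mulrDr mul1r mulr1 [x + x * y]addrC addrKA; apply.
Qed.
End Forward.

(** * Commutative ideals and commutators *)

Section GeneratedSubgroup.
Variables (G : groupType) (S T : set G).
Hypotheses (TS : T `<=` S) (SV : forall x, S x -> S x^-1%g).
Hypothesis (ST : forall x y, S x -> S y -> T [~ x, y]%g).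
Local Notation gen X := (smallest (@is_subgroup G) X).

(** Since [T] lies in [S], [h ^ g = h * [~ h, g]] shows that [S] normalizes the subgroup generated
    by [T]. Commutator identities then extend [ST] to each argument in turn. *)
Lemma generated_subgroup_comm x y : gen S x -> gen S y -> gen T [~ x, y]%g.
Proof.
have [T1 TD] := @smallest_subgroup G T.
have Sgen : S `<=` gen S by apply: sub_gen_smallest.
have Tgen : T `<=` gen T by apply: sub_gen_smallest.
have normS g : S g -> forall h, gen T h -> gen T (h ^ g)%g.
  move=> Sg h Hh; pose P : set G := [set h | gen T (h ^ g)%g].
  suff : P h by [].
  apply: Hh; split.
    by split=> [|a b Ha Hb]; rewrite /P /= ?conj1g // conjMg conjVg; apply: TD.
  move=> a Ta; rewrite /P /= (_ : a ^ g = a * [~ a, g])%g; last by rewrite commgEl mulVKg.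
  apply: (subgroup_mul (@smallest_subgroup G T)); first exact: Tgen.
  by apply: Tgen; apply: ST => //; apply: TS.
have normP g : gen S g -> forall h, gen T h -> gen T (h ^ g)%g /\ gen T (h ^ g^-1)%g.
  move=> Hg; pose P : set G := [set g | forall h, gen T h -> gen T (h ^ g)%g /\ gen T (h ^ g^-1)%g].
  suff : P g by [].
  apply: Hg; split.
    split=> [h Hh|a b Ha Hb h Hh]; first by rewrite invg1 conjg1.
    rewrite invgM invgK !conjgM; split; first by apply: (Hb _ _).2; apply: (Ha _ _).1.
    by apply: (Ha _ _).2; apply: (Hb _ _).1.
  by move=> a Sa h Hh; split; apply: normS => //; apply: SV.
have commP c : gen S c -> is_subgroup [set g | gen S g /\ gen T [~ g, c]%g].
  move=> Hc; have [S1 SD] := @smallest_subgroup G S.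
  split=> [|a b [Ha Ta] [Hb Tb]]; first by split=> //; rewrite comm1g.
  split; first exact: SD.
  have -> : ([~ a / b, c] = ([~ a, c] / [~ b, c]) ^ b^-1)%g.
    by rewrite !commgEl !conjgE !invgM !invgK !mulgA !mulgK.
  by apply: (normP _ Hb _ _).2; apply: TD.
have comm1 c : S c -> forall g, gen S g -> gen T [~ g, c]%g.
  move=> Sc g Hg; pose P : set G := [set g | gen S g /\ gen T [~ g, c]%g].
  suff [] : P g by [].
  apply: Hg; split; first by apply: commP; apply: Sgen.
  by move=> a Sa; split; [exact: Sgen|apply: Tgen; exact: ST].
move=> Hx Hy; pose P : set G := [set g | gen S g /\ gen T [~ g, y]%g].
suff [] : P x by [].
apply: Hx; split; first exact: commP.
move=> a Sa; split; first exact: Sgen.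
by rewrite -invgR; apply: (subgroup_inv (@smallest_subgroup G T)); apply: comm1.
Qed.

End GeneratedSubgroup.

Lemma bracket_subr1 (R : nzRingType) (a b : R) :
  (a - 1) * (b - 1) - (b - 1) * (a - 1) = a * b - b * a.
Proof.
have sub1 (x y : R) : (x - 1) * y - y * (x - 1) = x * y - y * x.
  by rewrite mulrBl mulrBr mul1r mulr1 opprB addrA subrK.
by rewrite sub1 -[LHS]opprB sub1 opprB.
Qed.

Lemma bracketBr (R : nzRingType) (x y z : R) :
  x * y - y * x - (x * z - z * x) = x * (y - z) - (y - z) * x.
Proof. by rewrite mulrBr mulrBl !opprB [LHS](AC (2*2) ((1*4)*(3*2))). Qed.

Section CommutativeIdeals.
Variables (F : fieldType) (A : algType F) (N : set A).
Hypothesis N_ideal : is_ideal_of [set: A] N.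
Implicit Types (K L : set A) (x y z : A).

Definition comm_mod K L := forall x y, L x -> L y -> K (x * y - y * x).

(** Ideals of [N / K] are handled as ideals of [N] containing [K]: these are the elements whose
    coset lies in a commutative ideal of [N / K]. *)
Definition in_comm_ideal K : set A := [set x | exists L,
  [/\ is_ideal_of N L, K `<=` L, comm_mod K L & L x]].

(** [L] is an ideal of [N] only, so multiplication by arbitrary elements of [A] may leave it;
    elements of [1 + N] are harmless. *)
Lemma ideal_absorb L l b : is_ideal_of N L -> N (b - 1) -> L l -> L (l * b) /\ L (b * l).
Proof.
move=> [_ Lsub LM] Nb Ll; have [LD _ _] := is_subspace_closed Lsub.
have [bl lb] := LM _ _ Nb Ll.
split; rewrite -(subrK 1 b); first by rewrite mulrDr mulr1; apply: LD.
by rewrite mulrDl mul1r; apply: LD.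
Qed.

Lemma uinv_1D L (u : ring_units A) : is_ideal_of N L -> L (uval u - 1) -> L (uinv u - 1).
Proof.
move=> HL Lu; have [LN Lsub _] := HL; have [_ LB _] := is_subspace_closed Lsub.
have Nu := LN _ Lu; have [_ Nsub NM] := N_ideal.
have [_ NB _] := is_subspace_closed Nsub.
have E : uinv u - 1 = 0 - (uval u - 1) * uinv u.
  by rewrite mulrBl uvalK mul1r sub0r opprB.
rewrite E; apply: LB; first by case: Lsub.
apply: (ideal_absorb HL _ Lu).1; rewrite E; apply: NB; first by case: Nsub.
exact: (NM _ _ Logic.I Nu).2.
Qed.

Section OneStep.
Variable K : set A.
Hypothesis K_ideal : is_ideal_of N K.
Local Notation S := (in_comm_ideal K).

Let Ksub : is_subspace K. Proof. by case: K_ideal. Qed.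
Let KD x y : K x -> K y -> K (x + y).
Proof. by have [H _ _] := is_subspace_closed Ksub; apply: H. Qed.
Let KB x y : K x -> K y -> K (x - y).
Proof. by have [_ H _] := is_subspace_closed Ksub; apply: H. Qed.
Let K0 : K 0. Proof. by case: Ksub. Qed.
Let KN x : K x -> K (- x).
Proof. by move=> Kx; rewrite -sub0r; apply: KB. Qed.
Let KT y x z : K (x - y) -> K (y - z) -> K (x - z).
Proof. by move=> H1 H2; rewrite -(subrK y x) -addrA; apply: KD. Qed.
Let KM n x : N n -> K x -> K (n * x) /\ K (x * n).
Proof. by move=> Nn Kx; case: K_ideal => _ _; apply. Qed.

(** Modulo [K], [xyz = zxy = xzy = zyx = yxz], each equality commuting two members of [L]. *)
Lemma comm_ideal_annihilate L x y z : is_ideal_of N L -> comm_mod K L ->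
  L x -> N y -> L z -> K ((x * y - y * x) * z).
Proof.
move=> [LN Lsub LM] Lc Lx Ny Lz.
have [Lyx Lxy] := LM _ _ Ny Lx; have [Lyz Lzy] := LM _ _ Ny Lz.
rewrite mulrBl; apply: (KT (y := z * (x * y))); first exact: Lc.
rewrite mulrA; apply: (KT (y := x * z * y)).
  by rewrite -mulrBl; apply: (KM Ny _).2; apply: Lc.
rewrite -mulrA; apply: (KT (y := z * y * x)); first exact: Lc.
by rewrite -mulrA; apply: Lc.
Qed.

(** With [x = u - 1] and [y = v - 1], the group commutator minus 1 is [[x, y] * u^-1 * v^-1]. By
    [comm_ideal_annihilate], applied once for each ideal, the two inverses act as 1 on [[x, y]]
    modulo [K]. *)
Lemma comm_mod_unit (u v : ring_units A) c d :
  S c -> S d -> K (uval u - 1 - c) -> K (uval v - 1 - d) ->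
  K (uval [~ u^-1, v^-1]%g - 1 - (c * d - d * c)).
Proof.
move=> [L [HL KL Lc Lc']] [M [HM KM' Mc Md]] Ku Kv.
have [LN Lsub _] := HL; have [MN Msub _] := HM.
have [LD _ _] := is_subspace_closed Lsub; have [MD _ _] := is_subspace_closed Msub.
pose x := uval u - 1; pose y := uval v - 1.
have Lx : L x by rewrite -[x](subrK c); apply: LD => //; apply: KL.
have My : M y by rewrite -[y](subrK d); apply: MD => //; apply: KM'.
have Lu : L (uinv u - 1) by apply: uinv_1D.
have Mv : M (uinv v - 1) by apply: uinv_1D.
pose w := x * y - y * x.
have E : uval [~ u^-1, v^-1]%g - 1 = w * uinv u * uinv v.
  rewrite /w bracket_subr1 !mulrBl -[uval v * _ * _]mulrA uvalK mulr1 uvalK.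
  by rewrite commgEl conjgE !invgK !uvalM !uvalV !mulrA.
have Kwu : K (w * (uinv u - 1)) by apply: (comm_ideal_annihilate HL) => //; apply: MN.
have Kwv : K (w * (uinv v - 1)).
  rewrite -[w]opprB mulNr; apply: KN.
  by apply: (comm_ideal_annihilate HM) => //; apply: LN.
rewrite E; apply: (KT (y := w)).
  apply: (KT (y := w * uinv v)).
    rewrite -mulrBl -{2}[w]mulr1 -mulrBr.
    by apply: (ideal_absorb K_ideal _ Kwu).1; apply: MN.
  by rewrite -{2}[w]mulr1 -mulrBr.
apply: (KT (y := x * d - d * x)).
  by rewrite bracketBr; have [] := KM (LN _ Lx) Kv; apply: KB.
have -> : x * d - d * x - (c * d - d * c) = - (d * (x - c) - (x - c) * d).
  by rewrite -bracketBr !opprB [RHS]addrC.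
by apply: KN; have [] := KM (MN _ Md) Ku => ? ?; apply: KB.
Qed.

(** No span is taken: these bare sets of iterated brackets generate both the Lie terms and, through
    [comm_layer_unit], the group terms. *)
Fixpoint comm_layer k : set A :=
  if k is j.+1 then [set x * y - y * x | x in comm_layer j & y in comm_layer j]
  else S.

Lemma in_comm_ideal_bracket c d : S c -> S d -> S (c * d - d * c).
Proof.
move=> [L [HL KL Lc Lc']] [M [[MN _ _] _ _ Md]]; exists L; split=> //.
have [_ Lsub LM] := HL; have [_ LB _] := is_subspace_closed Lsub.
by have [] := LM _ _ (MN _ Md) Lc' => ? ?; apply: LB.
Qed.

Lemma comm_layer_sub k : comm_layer k `<=` S.
Proof.
elim: k => // k IH _ [x /IH Sx [y /IH Sy <-]]; exact: in_comm_ideal_bracket.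
Qed.

Lemma comm_layerS k : comm_layer k.+1 `<=` comm_layer k.
Proof.
elim: k => [|k IH]; first exact: (comm_layer_sub (k := 1)).
by move=> _ [x /IH Sx [y /IH Sy <-]]; exists x => //; exists y.
Qed.

Lemma in_comm_ideal_sub : S `<=` N.
Proof. by move=> x [L [[LN _ _] _ _ /LN]]. Qed.

Definition comm_layer_unit k : set (ring_units A) :=
  [set u | exists2 c, comm_layer k c & K (uval u - 1 - c)].

Lemma comm_layer_unit_comm k u v : comm_layer_unit k u -> comm_layer_unit k v ->
  comm_layer_unit k.+1 [~ u^-1, v^-1]%g.
Proof.
move=> [c Cc Kc] [d Cd Kd]; exists (c * d - d * c); first by exists c => //; exists d.
by apply: comm_mod_unit => //; apply: comm_layer_sub; eassumption.
Qed.

Lemma comm_layer_unitS k : comm_layer_unit k.+1 `<=` comm_layer_unit k.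
Proof. by move=> u [c /comm_layerS Cc Kc]; exists c. Qed.

(** In layer 0, [u^-1 - 1] itself lies in the same commutative ideal. In a higher layer [- c] is the
    bracket in reverse order, and [c * (u^-1 - 1)] is in [K] by [comm_ideal_annihilate]. *)
Lemma comm_layer_unitV k u : comm_layer_unit k u -> comm_layer_unit k u^-1%g.
Proof.
move=> [c Cc Kc]; have [L [HL KL Lc Lc']] := comm_layer_sub Cc.
have [LN Lsub _] := HL; have [LD _ _] := is_subspace_closed Lsub.
have Lu : L (uval u - 1) by rewrite -[_ - 1](subrK c); apply: LD => //; apply: KL.
have Lu' := uinv_1D HL Lu.
case: k Cc => [|k] Cc.
  exists (uinv u - 1); last by rewrite uvalV subrr.
  by exists L.
case: Cc => x Cx [y Cy Dc]; exists (y * x - x * y).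
  by exists y => //; exists x.
have -> : y * x - x * y = - c by rewrite -Dc opprB.
rewrite uvalV opprK.
have Kcu : K (c * (uinv u - 1)).
  have [L1 [HL1 KL1 Lc1 Lx]] := comm_layer_sub Cx.
  have [_ L1sub L1M] := HL1; have [L1D L1B _] := is_subspace_closed L1sub.
  have Ny := in_comm_ideal_sub (comm_layer_sub Cy).
  have L1c : L1 c by rewrite -Dc; have [] := L1M _ _ Ny Lx => ? ?; apply: L1B.
  have L1u : L1 (uval u - 1) by rewrite -[_ - 1](subrK c); apply: L1D => //; apply: KL1.
  by rewrite -Dc; apply: (comm_ideal_annihilate HL1) => //; apply: uinv_1D.
have -> : uinv u - 1 + c = - ((uval u - 1 - c) * uinv u) - c * (uinv u - 1).
  rewrite !(mulrBl, mulrBr) uvalK mul1r mulr1 !opprB.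
  by rewrite [RHS]addrC [RHS]addrA subrK addrC.
apply: KB => //; apply: KN; apply: (ideal_absorb K_ideal _ Kc).1.
exact: LN.
Qed.

End OneStep.
End CommutativeIdeals.

Lemma bracket_span (F : fieldType) (A : algType F) (X P : set A) : is_subspace P ->
  (forall x y, X x -> X y -> P (x * y - y * x)) ->
  forall x y, smallest (@is_subspace F A) X x -> smallest (@is_subspace F A) X y ->
    P (x * y - y * x).
Proof.
move=> [P0 PD] XP.
have lin (k : F) (x y z : A) : (k *: x + y) * z - z * (k *: x + y) =
    k *: (x * z - z * x) + (y * z - z * y).
  rewrite mulrDl mulrDr -scalerAl -scalerAr scalerBr.
  by rewrite opprD [LHS](AC (2*2) ((1*3)*(2*4))).
have right x : X x -> forall y, smallest (@is_subspace F A) X y -> P (y * x - x * y).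
  move=> Xx y Hy; pose T := [set y : A | P (y * x - x * y)]; suff : T y by [].
  apply: Hy; split; last by move=> z Xz; exact: XP.
  split; first by rewrite /T /= mul0r mulr0 subrr.
  by move=> k a b Ta Tb; rewrite /T /= lin; apply: PD.
move=> x y Hx Hy; pose T := [set x : A | P (x * y - y * x)]; suff : T x by [].
apply: Hx; split.
  split; first by rewrite /T /= mul0r mulr0 subrr.
  by move=> k a b Ta Tb; rewrite /T /= lin; apply: PD.
move=> z Xz; rewrite /T /= -opprB -[- _]addr0 -scaleN1r.
by apply: PD => //; apply: right.
Qed.

(** * Exchange of derived lengths across one factor of the chain *)

Section Steps.
Variables (F : fieldType) (A : algType F) (N K I : set A).
Hypothesis N_ideal : is_ideal_of [set: A] N.
Hypothesis N_unit : forall x, N x -> exists u : ring_units A, uval u = 1 + x.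
Hypothesis K_ideal : is_ideal_of N K.
Hypothesis I_sum : forall x, I x -> exists n (y : 'I_n -> A),
  (forall i, in_comm_ideal N K (y i)) /\ K (x - \sum_(i < n) y i).
Local Notation C := (comm_layer N K).
Local Notation span X := (smallest (@is_subspace F A) X).
Variable n : nat.

Lemma comm_layer_derived k c : C k c ->
  exists2 u : ring_units A, derived_series k u & K (uval u - 1 - c).
Proof.
have [_ [K0 _] _] := K_ideal.
elim: k c => [|k IH] c.
  move=> /in_comm_ideal_sub/N_unit [u Du]; exists u => //.
  by rewrite Du [1 + c]addrC addrK subrr.
case=> x Cx [y Cy <-]; have [u Du Ku] := IH _ Cx; have [v Dv Kv] := IH _ Cy.
exists [~ u^-1, v^-1]%g; last first.
  by apply: (comm_mod_unit N_ideal K_ideal) => //; apply: comm_layer_sub; eassumption.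
by apply: derived_series_comm; apply: subgroup_inv => //; apply: derived_series_subgroup.
Qed.

(** From [I] on, the Lie derived series stays in the span of [C k] and [K]. Each element of [C n] is
    congruent to [u - 1] modulo [K] for a unit [u] in the trivial group [D n], hence lies in [K]. *)
Lemma lie_step m : @derived_series (ring_units A) n = [set 1%g] ->
  lie_derived_series (A := A) m `<=` I -> lie_derived_series (A := A) (m + n) `<=` K.
Proof.
move=> Dn HI; have [KN Ksub KM] := K_ideal; have [KD KB KZ] := is_subspace_closed Ksub.
pose T k := span (C k `|` K).
have Tsub k : is_subspace (T k) by apply: smallest_subspace.
have genT k : C k `|` K `<=` T k by apply: sub_gen_smallest.
have key k : lie_derived_series (A := A) (m + k) `<=` T k.
  elim: k => [|k IH].
    rewrite addn0 => x /HI/I_sum [j [y [Sy Kx]]].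
    have [TD _ _] := is_subspace_closed (Tsub 0%N).
    rewrite -(subrK (\sum_(i < j) y i) x); apply: (TD); first by apply: genT; right.
    elim/big_ind: _ => //; first by case: (Tsub 0%N).
    by move=> i _; apply: genT; left; apply: Sy.
  rewrite addnS /=; apply: smallest_sub; first exact: Tsub.
  move=> _ [x /IH Tx [y /IH Ty <-]].
  apply: (bracket_span (X := C k `|` K)) Tx Ty; first exact: Tsub.
  have CN c : C k c -> N c by move=> Cc; exact: in_comm_ideal_sub (comm_layer_sub Cc).
  move=> a b Ha Hb; apply: genT.
  case: Ha Hb => [Ca|Ka] [Cb|Kb].
  - by left; exists a => //; exists b.
  - by right; have [] := KM _ _ (CN _ Ca) Kb => ? ?; apply: KB.
  - by right; have [] := KM _ _ (CN _ Cb) Ka => ? ?; apply: KB.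
  - by right; have [] := KM _ _ (KN _ Ka) Kb => ? ?; apply: KB.
apply: subset_trans (key n) _; apply: smallest_sub => // x [Cx|//].
have [u] := comm_layer_derived Cx; rewrite Dn => -> /(KZ (- 1)).
by rewrite uval1 subrr sub0r scaleN1r opprK.
Qed.

Lemma comm_layer_lie k : C k `<=` lie_derived_series (A := A) k.
Proof.
elim: k => [//|k IH] _ [x /IH Lx [y /IH Ly <-]] S [_]; apply.
by exists x => //; exists y.
Qed.

(** Mirror image of [lie_step]: the group terms stay in the subgroup generated by [comm_layer_unit],
    and [C n] vanishes because it lies in the Lie derived series. *)
Lemma group_step j : lie_derived_series (A := A) n = [set 0] ->
  (forall u, @derived_series (ring_units A) j u -> I (uval u - 1)) ->
  forall u, @derived_series (ring_units A) (j + n) u -> K (uval u - 1).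
Proof.
move=> Ln HI; have [KN Ksub KM] := K_ideal; have [KD KB KZ] := is_subspace_closed Ksub.
have K0 : K 0 by case: Ksub.
pose H k := smallest (@is_subgroup (ring_units A)) (comm_layer_unit N K k).
have genH k : comm_layer_unit N K k `<=` H k by apply: sub_gen_smallest.
have S0 : in_comm_ideal N K 0.
  exists K; split=> // x y Kx Ky; have [] := KM _ _ (KN _ Kx) Ky => ? ?; exact: KB.
(* A unit congruent to [1 + y_1 + ... + y_q] is factored by splitting off [w = 1 + c] with [c] the
   last summand; the remaining factor [w^-1 * u] is congruent to 1 plus the [q - 1] terms
   [w^-1 * y_i]. *)
have base q : forall (y : 'I_q -> A) u, (forall i, in_comm_ideal N K (y i)) ->
    K (uval u - 1 - \sum_(i < q) y i) -> H 0%N u.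
  elim: q => [|q IH] y u Sy.
    by rewrite big_ord0 => Ku; apply: genH; exists 0.
  rewrite big_ord_recr /= => Ku; pose c := y ord_max.
  have Sc : in_comm_ideal N K c by apply: Sy.
  have [w Dw] := N_unit (in_comm_ideal_sub Sc).
  have Nw : N (uinv w - 1).
    apply: (uinv_1D N_ideal) => //; last first.
      by rewrite Dw [1 + c]addrC addrK; apply: in_comm_ideal_sub Sc.
    by case: N_ideal => _ Nsub NM; split=> // b x _; apply: NM.
  have -> : u = (w * (w^-1 * u))%g by rewrite mulVKg.
  apply: (subgroup_mul (@smallest_subgroup _ _)).
    by apply: genH; exists c => //; rewrite Dw [1 + c]addrC addrK subrr.
  apply: (IH (fun i => uinv w * y (widen_ord (leqnSn q) i))).
    move=> i; have [L [HL KL Lc Ly]] := Sy (widen_ord (leqnSn q) i).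
    by exists L; split=> //; apply: (ideal_absorb HL Nw Ly).2.
  have := (ideal_absorb K_ideal Nw Ku).2; congr K.
  rewrite -mulr_sumr uvalM uvalV mulrBr mulrBr mulr1 mulrDr -/c.
  have -> : uinv w * c = 1 - uinv w.
    have -> : c = uval w - 1 by rewrite Dw [1 + c]addrC addrK.
    by rewrite mulrBr uinvK mulr1.
  by rewrite opprD opprB [LHS](AC (2*(1*2)) ((1*5*3)*(4*2))) /= subrr addr0.
have comm k : H k `<=` [set u | forall v, H k v -> H k.+1 [~ u, v]%g].
  move=> u Hu v Hv; apply: (generated_subgroup_comm (S := comm_layer_unit N K k)) => //.
  - exact: comm_layer_unitS.
  - by move=> x; apply: (comm_layer_unitV N_ideal K_ideal).
  - move=> x y Cx Cy; rewrite -[x]invgK -[y]invgK.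
    by apply: comm_layer_unit_comm => //; apply: (comm_layer_unitV N_ideal K_ideal).
have key k : @derived_series (ring_units A) (j + k) `<=` H k.
  elim: k => [|k IH].
    by rewrite addn0 => u /HI/I_sum [q [y [Sy Ku]]]; apply: base Sy Ku.
  rewrite addnS /=; apply: smallest_sub; first exact: smallest_subgroup.
  by move=> _ [u /IH Hu [v /IH Hv <-]]; apply: comm.
move=> u /key Hu; pose T : set (ring_units A) := [set u | K (uval u - 1)].
suff : T u by [].
apply: Hu; split.
  split=> [|x y Tx Ty]; first by rewrite /T /= uval1 subrr.
  have Ty' := uinv_1D N_ideal K_ideal Ty.
  rewrite /T /= uvalM uvalV.
  have -> : uval x * uinv y - 1 = (uval x - 1) * uinv y + (uinv y - 1).
    by rewrite mulrBl mul1r addrA subrK.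
  by apply: KD => //; apply: (ideal_absorb K_ideal _ Tx).1; apply: KN.
move=> v [c /comm_layer_lie]; rewrite Ln => ->; by rewrite subr0.
Qed.

End Steps.

(** * Chains of ideals *)

Section Cosets.
Variables (F : fieldType) (A : algType F).
Implicit Types (N K I L : set A) (x y : A).

Lemma coset_of_setP K x y : is_subspace K ->
  coset_of_set K x = coset_of_set K y <-> K (x - y).
Proof.
move=> Ksub; have [KD KB _] := is_subspace_closed Ksub; have K0 : K 0 by case: Ksub.
split=> [xy|Kxy].
  have : coset_of_set K x x by exists 0; rewrite ?addr0.
  by rewrite xy => -[k Kk <-]; rewrite addrC addKr.
apply/seteqP; split=> _ [k Kk <-].
  by exists (x - y + k); [apply: KD|rewrite addrA [y + _]addrC subrK].
exists (k - (x - y)); first exact: KB.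
by rewrite opprB addrCA [x + _]addrC subrK addrC.
Qed.

Lemma sum_of_commutative_ideals_decode N K I : is_subspace N -> is_ideal_of N K ->
  sum_of_commutative_ideals N K (quotient_set I K) ->
  forall x, I x -> exists n (y : 'I_n -> A),
    (forall i, in_comm_ideal N K (y i)) /\ K (x - \sum_(i < n) y i).
Proof.
move=> /is_subspace_closed [_ NB _] [KN Ksub KM] [KK [HKK DI]] x Ix.
have : quotient_set I K (coset_of_set K x) by exists x.
rewrite DI => -[n [y [Hy /(coset_of_setP _ _ Ksub) Kx]]].
exists n, y; split=> // i; have [L KL Ly] := Hy i.
have [[LN L0 LD LM] Lc] := HKK _ KL.
exists [set z | L (coset_of_set K z)]; split=> //.
- split=> [| //|b z Nb Lz]; last exact: LM Nb Lz.
  move=> z Lz; have [b Nb /(coset_of_setP _ _ Ksub) Kbz] := LN _ Lz.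
  have -> : z = b - (b - z) by rewrite opprB addrC subrK.
  by apply: NB => //; apply: KN.
- move=> k Kk /=; suff -> : coset_of_set K k = coset_of_set K 0 by [].
  by apply/coset_of_setP; rewrite ?subr0.
- by move=> a b La Lb; apply/(coset_of_setP _ _ Ksub)/Lc.
Qed.

(** The family consists of the images of all suitable [L] between [K] and [I]: containing [K] lets
    membership of a coset descend to [L], and lying in [I] keeps the sum from exceeding [I / K]. *)
Lemma sum_of_commutative_ideals_encode N K I : is_ideal_of N K -> is_subspace I ->
  (forall x, I x -> exists n (y : 'I_n -> A), x = \sum_(i < n) y i /\
    forall i, exists L, [/\ is_ideal_of N L, K `<=` L, L `<=` I, comm_mod K L & L (y i)]) ->
  sum_of_commutative_ideals N K (quotient_set I K).
Proof.
move=> [KN Ksub KM] Isub HI; have [ID _ _] := is_subspace_closed Isub.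
pose good L := [/\ is_ideal_of N L, K `<=` L, L `<=` I & comm_mod K L].
have image L x : good L -> (coset_of_set K @` L) (coset_of_set K x) -> L x.
  move=> [[_ Lsub _] KL _ _] [l Ll /esym/(coset_of_setP _ _ Ksub) Kxl].
  have [LD _ _] := is_subspace_closed Lsub.
  by rewrite -(subrK l x); apply: LD => //; apply: KL.
exists [set Q | exists2 L, good L & Q = coset_of_set K @` L]; split.
  move=> _ [L HL ->]; have [[LN [L0 LD] LM] KL LI Lc] := HL; split; last first.
    by move=> x y /(image _ _ HL) Lx /(image _ _ HL) Ly; apply/coset_of_setP => //; apply: Lc.
  split.
  - by move=> _ [l /LN Nl <-]; exists l.
  - by exists 0.
  - move=> k x y /(image _ _ HL) Lx /(image _ _ HL) Ly.
    by exists (k *: x + y) => //; apply: LD.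
  - move=> b x Nb /(image _ _ HL) Lx.
    by have [bx xb] := LM _ _ Nb Lx; split; [exists (b * x)|exists (x * b)].
apply/seteqP; split=> [_ [x Ix <-]|_ [n [y [Hy ->]]]].
  have [n [y [Dx Hy]]] := HI _ Ix.
  exists n, y; split; last by rewrite Dx.
  move=> i; have [L [HL KL LI Lc Ly]] := Hy i.
  by exists (coset_of_set K @` L); [exists L|exists (y i)].
exists (\sum_(i < n) y i) => //.
elim/big_ind: _ => //; first by case: Isub.
move=> i _; have [_ [L HL ->] /(image _ _ HL) Ly] := Hy i.
by case: HL => _ _ LI _; apply: LI.
Qed.

Lemma rad_step_sum I x : is_ideal_of [set: A] I -> rad_step I x ->
  exists n (y : 'I_n -> A), x = \sum_(i < n) y i /\ forall i b, I (y i * b * y i).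
Proof.
move=> [_ Isub IM] Hx; have [_ _ IZ] := is_subspace_closed Isub.
pose T := [set x : A | exists n (y : 'I_n -> A),
  x = \sum_(i < n) y i /\ forall i b, I (y i * b * y i)].
suff : T x by [].
apply: Hx; split; last first.
  by move=> y Hy; exists 1%N, (fun=> y); rewrite big_ord1; split.
split; first by exists 0%N, (fun=> 0); rewrite big_ord0; split=> // -[].
move=> k _ _ [m [a [-> Ha]]] [n [b [-> Hb]]].
exists (m + n)%N, (fun i => match fintype.split i with inl j => k *: a j | inr j => b j end).
split.
  rewrite big_split_ord scaler_sumr /=; congr (_ + _); apply: eq_bigr => i _.
    by rewrite -[lshift n i]/(unsplit (inl i)) unsplitK.
  by rewrite -[rshift m i]/(unsplit (inr i)) unsplitK.
move=> i c; case: (fintype.split i) => j //.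
by rewrite -!scalerAl -scalerAr; apply/IZ/IZ/Ha.
Qed.

(** [L] is the ideal generated by [I] and [x]. Induction on generation in each variable gives
    [y * b * z] in [I] for [y], [z] in [L], so the square of [L] lies in [I], which is stronger than
    commutativity. *)
Lemma rad_step_comm_ideal I x : is_ideal_of [set: A] I -> (forall b, I (x * b * x)) ->
  exists L, [/\ is_ideal_of [set: A] L, I `<=` L, L `<=` rad_step I, comm_mod I L & L x].
Proof.
move=> HI Hx; have [_ [I0 ID] IM] := HI.
pose L := smallest (is_ideal_of [set: A]) (I `|` [set x]).
have sub P : is_ideal_of [set: A] P -> I `<=` P -> P x -> L `<=` P.
  by move=> HP IP Px; apply: smallest_sub => // y [/IP//|->].
have genL : I `|` [set x] `<=` L by apply: sub_gen_smallest.
have L1 y : L y -> forall b, I (x * b * y).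
  move: y; apply: (sub [set y | forall b, I (x * b * y)]) => //.
    split=> //.
      split=> [b /=|k y z Hy Hz b /=]; first by rewrite mulr0.
      by rewrite mulrDr -scalerAr; apply: ID.
    move=> a y _ Hy; split=> b /=; first by rewrite mulrA -(mulrA x).
    by rewrite mulrA; apply: (IM _ _ Logic.I (Hy b)).2.
  by move=> y Iy b; apply: (IM _ _ Logic.I Iy).1.
have L2 z : L z -> forall y b, L y -> I (z * b * y).
  move: z; apply: (sub [set z | forall y b, L y -> I (z * b * y)]).
  - split=> //.
      split=> [y b _ /=|k a c Ha Hc y b Ly /=]; first by rewrite !mul0r.
      by rewrite !mulrDl -!scalerAl; apply: ID; [apply: Ha|apply: Hc].
    move=> a z _ Hz; split=> y b Ly /=; last by rewrite -(mulrA z); apply: Hz.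
    by rewrite -!mulrA (mulrA z); apply: (IM _ _ Logic.I (Hz _ _ Ly)).1.
  - by move=> z Iz y b _; rewrite -mulrA; apply: (IM _ _ Logic.I Iz).2.
  - by move=> y b Ly; apply: L1.
have Lideal : is_ideal_of [set: A] L.
  split=> //.
    split=> [P [[_ [P0 _] _] _] //|k y z Ly Lz P HP].
    by have [[_ [_ PD] _] _] := HP; apply: PD; [apply: Ly|apply: Lz].
  move=> b y _ Ly; split=> P HP; have [[_ _ PM] _] := HP.
    exact: (PM _ _ Logic.I (Ly _ HP)).1.
  exact: (PM _ _ Logic.I (Ly _ HP)).2.
exists L; split=> //.
- by move=> y Iy; apply: genL; left.
- apply: sub; [exact: rad_step_ideal|exact: sub_rad_step|exact: rad_step_gen].
- have [_ IB _] := is_subspace_closed (conj I0 ID).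
  move=> y z Ly Lz; apply: IB.
    by rewrite -[y]mulr1; apply: L2.
  by rewrite -[z]mulr1; apply: L2.
- by apply: genL; right.
Qed.

End Cosets.

(** * Solvability along a chain of ideals of the radical *)

Section Chain.
Variables (F : fieldType) (A : algType F).
Hypothesis A_alg : algebraic_algebra A.
Local Notation R := (@jacobson_radical A).
Variables (m : nat) (J : nat -> set A).
Hypotheses (J0 : J 0%N = [set 0]) (Jm : J m = R).
Hypothesis J_ideal : forall i, (i <= m)%N -> is_ideal_of R (J i).
Hypothesis J_sum : forall i, (1 <= i <= m)%N ->
  sum_of_commutative_ideals (J m) (J i.-1) (quotient_set (J i) (J i.-1)).
Hypothesis R_comm : forall x y, R (x * y - y * x).

Lemma chain_descent (P : set A -> Prop) : P R ->
  (forall K I, is_ideal_of R K ->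
     (forall x, I x -> exists n (y : 'I_n -> A),
        (forall i, in_comm_ideal R K (y i)) /\ K (x - \sum_(i < n) y i)) ->
     P I -> P K) ->
  P [set 0].
Proof.
move=> PR Pstep; rewrite -J0.
have key j : forall i, (i + j)%N = m -> P (J i).
  elim: j => [i|j IH i Di]; first by rewrite addn0 => ->; rewrite Jm.
  have im : (i < m)%N by rewrite -Di addnS ltnS leq_addr.
  have Ji := J_ideal (ltnW im).
  apply: (Pstep _ (J i.+1)) => //; last by apply: IH; rewrite addSn -addnS.
  apply: sum_of_commutative_ideals_decode => //; first by case: (jacobson_ideal A_alg).
  by rewrite -Jm; apply: (J_sum (i := i.+1)).
exact: key (add0n m).
Qed.

(** By [R_comm] the first Lie derived term lies in the radical; every factor of the chain costs [n]
    further terms, [n] being the derived length of the group. *)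
Lemma chain_lie_solvable : group_solvable (ring_units A) -> lie_solvable A.
Proof.
move=> [n Dn]; have R_ideal := jacobson_ideal A_alg.
suff [k Hk] : exists k, lie_derived_series (A := A) k `<=` [set 0].
  exists k; apply/seteqP; split=> // _ ->.
  by case: k {Hk} => // k; apply: (smallest_subspace _).1.
apply: (chain_descent (P := fun I => exists k, lie_derived_series (A := A) k `<=` I)).
  exists 1%N; apply: smallest_sub; first by case: R_ideal.
  by move=> _ [x _ [y _ <-]]; apply: R_comm.
move=> K I HK HI [k Hk]; exists (k + n)%N.
apply: (lie_step R_ideal (@one_add_jacobson_unit _ _ A_alg) HK HI Dn Hk).
Qed.

Lemma chain_group_solvable : lie_solvable A -> group_solvable (ring_units A).
Proof.
move=> [n Ln]; have R_ideal := jacobson_ideal A_alg.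
have [_ Rsub RM] := R_ideal; have [RD RB _] := is_subspace_closed Rsub.
suff [k Hk] : exists k, forall u, @derived_series (ring_units A) k u -> [set 0] (uval u - 1).
  exists k; apply/seteqP; split=> [u /Hk /eqP|_ ->]; last first.
    by case: (@derived_series_subgroup (ring_units A) k).
  by rewrite subr_eq0 => /eqP u1; apply: uval_inj.
apply: (chain_descent (P := fun I => exists k, forall u,
    @derived_series (ring_units A) k u -> I (uval u - 1))).
  exists 1%N => u Du; pose T : set (ring_units A) := [set u | R (uval u - 1)].
  suff : T u by [].
  apply: Du; split.
    split=> [|x y Tx Ty]; first by rewrite /T /= uval1 subrr; case: Rsub.
    rewrite /T /= uvalM uvalV.
    have -> : uval x * uinv y - 1 = (uval x - 1 - (uval y - 1)) * uinv y.
      by rewrite opprB addrA subrK mulrBl uvalK.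
    by apply: (RM _ _ Logic.I _).2; apply: RB.
  move=> _ [x _ [y _ <-]].
  rewrite /T /= commgEl conjgE !uvalM !uvalV.
  have -> : uinv x * (uinv y * (uval x * uval y)) - 1 =
      uinv x * uinv y * (uval x * uval y - uval y * uval x).
    rewrite mulrBr -[uinv x * uinv y * (uval y * _)]mulrA [uinv y * (uval y * _)]mulrA.
    by rewrite uinvK mul1r uinvK !mulrA.
  exact: (RM _ _ Logic.I (R_comm _ _)).1.
move=> K I HK HI [k Hk]; exists (k + n)%N.
exact: (group_step R_ideal (@one_add_jacobson_unit _ _ A_alg) HK HI Ln Hk).
Qed.

End Chain.

Lemma jacobson_chain (F : fieldType) (A : algType F) (c : nat) :
  algebraic_algebra A ->
  (forall x y : A, jacobson_radical x -> jacobson_radical y ->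
    iter c (@rad_step F A) [set 0] (x * y - y * x)) ->
  exists (m : nat) (J : nat -> set A),
    [/\ J 0%N = [set 0],
        J m = @jacobson_radical A,
        (forall i, (i < m)%N -> J i `<=` J i.+1),
        (forall i, (i <= m)%N -> is_ideal_of (@jacobson_radical A) (J i))
      & forall i, (1 <= i <= m)%N ->
          sum_of_commutative_ideals (J m) (J i.-1) (quotient_set (J i) (J i.-1))].
Proof.
move=> A_alg Hc; have R_ideal := jacobson_ideal A_alg.
pose rad i := iter i (@rad_step F A) [set 0].
(* The last member, of index [c.+1], is the radical itself: it is commutative modulo [rad c], so the
   top factor is a single commutative ideal. *)
pose J i := if (i <= c)%N then rad i else @jacobson_radical A.
have rad_ideal i : is_ideal_of [set: A] (rad i).
  exact: iter_rad_step_ideal (zero_ideal A).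
have radR i : rad i `<=` @jacobson_radical A.
  by apply: iter_rad_step_jacobson => // _ ->; case: R_ideal => _ [].
have sub_ideal L : L `<=` @jacobson_radical A -> is_ideal_of [set: A] L ->
    is_ideal_of (@jacobson_radical A) L.
  by move=> LR [_ Lsub LM]; split=> // b x _ Lx; apply: LM.
have JR i : is_ideal_of [set: A] (J i) /\ J i `<=` @jacobson_radical A.
  by rewrite /J; case: ifP => _; split.
exists c.+1, J; split.
- by rewrite /J leq0n.
- by rewrite /J ltnn.
- move=> i; rewrite ltnS => ic; rewrite {1}/J ic; have [_] := JR i.+1.
  rewrite /J; case: ifP => // _ _; exact: sub_rad_step.
- by move=> i _; case: (JR i) => ? ?; apply: sub_ideal.
move=> [//|i] /= ic; rewrite {1}/J ltnn.
have Dk : J i = rad i by rewrite /J -ltnS ic.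
rewrite Dk; apply: sum_of_commutative_ideals_encode; first exact: sub_ideal.
  by have [[_ ? _] _] := JR i.+1.
move=> x; rewrite /J; case: ifP => ic'.
  move=> /(rad_step_sum (rad_ideal i)) [n [y [-> Hy]]]; exists n, y; split=> // j.
  have [L [HL KL LI Lc Ly]] := rad_step_comm_ideal (rad_ideal i) (Hy j).
  exists L; split=> //; apply: sub_ideal => //.
  by apply: subset_trans LI (radR i.+1).
move=> Rx; exists 1%N, (fun=> x); rewrite big_ord1; split=> // _.
have Di : i = c by apply/eqP; rewrite eqn_leq -ltnS ic leqNgt ic'.
by exists (@jacobson_radical A); split=> //; [apply: sub_ideal|rewrite Di].
Qed.

Theorem theorem2p1 (F : fieldType) (A : algType F)
    (F_ge4 : (`I_4 #<= [set: F])%card)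
    (A_alg : algebraic_algebra A) :
  group_solvable (ring_units A) <->
  [/\ lie_solvable A,
      quotient_commutative (@jacobson_radical A)
        (quotient_set [set: A] (@jacobson_radical A))
    & exists (m : nat) (J : nat -> set A),
        [/\ J 0%N = [set 0],
            J m = @jacobson_radical A,
            (forall i, (i < m)%N -> J i `<=` J i.+1),
            (forall i, (i <= m)%N -> is_ideal_of (@jacobson_radical A) (J i))
          & forall i, (1 <= i <= m)%N ->
              sum_of_commutative_ideals (J m) (J i.-1)
                (quotient_set (J i) (J i.-1))]].
Proof.
have [_ Rsub _] := jacobson_ideal A_alg.
split=> [A_solv|[A_lie A_comm [m [J [J0 Jm _ J_ideal J_sum]]]]].
  have [t0 [t00 t01 t0N1]] := exists_scalar F_ge4; have [n Dn] := A_solv.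
  have R_comm := commutator_jacobson t00 t01 t0N1 A_alg Dn.
  have [c Hc] := jacobson_commutator_rad t00 t01 t0N1 A_alg Dn.
  have chain := jacobson_chain A_alg Hc; split=> //.
    (* Lie solvability is read off the chain just constructed, together with the solvability of the
       group. *)
    have [m [J [J0 Jm _ J_ideal J_sum]]] := chain.
    exact: (chain_lie_solvable A_alg J0 Jm J_ideal J_sum R_comm).
  by move=> x y _ _; apply/coset_of_setP => //; apply: R_comm.
apply: (chain_group_solvable A_alg J0 Jm J_ideal J_sum) => // x y.
by apply/(coset_of_setP _ _ Rsub)/A_comm; [exists x|exists y].
Qed.
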